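(* Let $\alpha>0$, $\delta>0$, $\theta_0\in\mathbb{R}$, and let $\{P_\theta:|\theta-\theta_0|<\delta\}$ be a statistical model with real parameter that is Hellinger differentiable with Fisher information $\mathcal{I}(t)$ for $|t-\theta_0|<\delta$. Let $X=(X_1,\dots,X_n)$ be $n$ IID observations from $P_\theta$ and let $\psi(P_\theta)=\max(0,\theta^\alpha)$, i.e. $\psi(P_\theta)=\theta^\alpha$ for $\theta>0$ and $0$ for $\theta\le0$. Then: (i) if $\theta_0<0$, $$\inf_T\sup_{|\theta-\theta_0|<\delta}\mathbb{E}_\theta|T(X)-\psi(P_\theta)|^2\ge\sup_{Q,\varphi_0}\frac{\delta^2\alpha^2\left|\mathbb{E}_Q\big[\{\theta_0+\delta\varphi_0(t)\}^{\alpha-1}\varphi_0'(t)\,\mathbf{1}\{|\theta_0|/\delta<\varphi_0(t)\}\big]\right|^2}{\mathcal{I}(Q)+n\delta^2\,\mathbb{E}_Q\big[\{\varphi_0'(t)\}^2\,\mathcal{I}(\theta_0+\delta\varphi_0(t))\big]};$$ (ii) if $\theta_0>0$, $$\inf_T\sup_{|\theta-\theta_0|<\delta}\mathbb{E}_\theta|T(X)-\psi(P_\theta)|^2\ge\sup_{Q,\varphi_0}\frac{\delta^2\alpha^2\left|\mathbb{E}_Q\big[\{\theta_0+\delta\varphi_0(t)\}^{\alpha-1}\varphi_0'(t)\,\mathbf{1}\{\varphi_0(t)<\theta_0/\delta\}\big]\right|^2}{\mathcal{I}(Q)+n\delta^2\,\mathbb{E}_Q\big[\{\varphi_0'(t)\}^2\,\mathcal{I}(\theta_0+\delta\varphi_0(t))\big]};$$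 (iii) if $\theta_0=0$, $$\inf_T\sup_{|\theta|<\delta}\mathbb{E}_\theta|T(X)-\psi(P_\theta)|^2\ge\sup_{Q,\varphi_0}\frac{\delta^{2\alpha}\alpha^2\left|\mathbb{E}_Q\big[\varphi_0(t)^{\alpha-1}\varphi_0'(t)\,\mathbf{1}\{\varphi_0(t)>0\}\big]\right|^2}{\mathcal{I}(Q)+n\delta^2\,\mathbb{E}_Q\big[\{\varphi_0'(t)\}^2\,\mathcal{I}(\delta\varphi_0(t))\big]}.$$ The infima are over measurable real-valued functions $T$ of $X$; the suprema are over probability measures $Q$ on $\mathbb{R}$ and increasing diffeomorphisms $\varphi_0:\mathbb{R}\to(-1,1)$ with $\varphi_0(0)=0$ and $\|\varphi_0'\|_\infty<C$ for some constant $C$.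
   Context: All $P_\theta$ have densities with respect to a common $\sigma$-finite measure $\nu$; $\mathbb{E}_\theta$ is expectation under $n$ IID observations from $P_\theta$; $\mathbb{E}_Q$ is expectation over $t\sim Q$. Hellinger differentiability at $t$: there is $\dot\xi_t\in L_2(\nu)$ with $\int[dP_{t+h}^{1/2}-dP_t^{1/2}-h\dot\xi_t]^2d\nu=o(h^2)$ as $h\to0$; $\mathcal{I}(t)=4\int\dot\xi_t^2\,d\nu$. For $Q$ with absolutely continuous Lebesgue density $q$, $\mathcal{I}(Q)=\int (q')^2q^{-1}\mathbf{1}\{q>0\}\,dt$ is the Fisher information of its location family; measures $Q$ without such a density or with $\mathcal{I}(Q)=\infty$ (or an infinite second term in the denominator) contribute the value $0$ to the supremum. Products inside $\mathbb{E}_Q$ are $0$ where the indicator vanishes.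
   Formalization: In (ii), where θ0+δφ0(t) ≤ 0 (possible when θ0<δ), the power {θ0+δφ0(t)}^{α-1} is read as 0 for every α, integers included; there it is otherwise undefined, or for integer α such as α=1 makes the stated inequality false. *)

(* Defs.v *)
From HB Require Import structures.
From mathcomp Require Import all_boot all_order all_algebra.
From mathcomp Require Import all_classical all_reals all_analysis.

Set Implicit Arguments.
Unset Strict Implicit.
Unset Printing Implicit Defensive.

Import Order.TTheory GRing.Theory Num.Theory.
Import numFieldNormedType.Exports.

Local Open Scope classical_set_scope.
Local Open Scope ring_scope.

Section iid.
Context d (X : measurableType d) (R : realType).

Definition cons_pair n (z : X * n.-tuple X) : n.+1.-tuple X :=
  [tuple of z.1 :: z.2].

Lemma measurable_cons_pair n : measurable_fun [set: X * n.-tuple X] (@cons_pair n).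
Proof. exact: measurable_cons. Qed.

HB.instance Definition _ n := isMeasurableFun.Build _ _ _ _ (@cons_pair n)
  (@measurable_cons_pair n).

(* The n-fold product measure of [P] on tuples, characterized by
   [iid_law_box] below. *)
Fixpoint iid_law (P : probability X R) (n : nat) : probability (n.-tuple X) R :=
  match n with
  | 0 => \d_([tuple] : 0.-tuple X)
  | m.+1 => distribution (P \x iid_law P m)%E (@cons_pair m)
  end.

Lemma iid_law_box (P : probability X R) n (A : 'I_n -> set X) :
  (forall i, measurable (A i)) ->
  iid_law P n [set x | forall i, A i (tnth x i)] = (\prod_(i < n) P (A i))%E.
Proof.
elim: n A => [|n IHn] A mA /=.
  rewrite big_ord0 /dirac indicE (_ : _ \in _ = true) //.
  by apply/mem_set => /= -[].
have mbox : measurable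
    [set x : n.-tuple X | forall i, A (lift ord0 i) (tnth x i)].
  rewrite (_ : [set x | _] = \bigcap_(i in [set: 'I_n])
      ((fun x : n.-tuple X => tnth x i) @^-1` A (lift ord0 i))).
    apply: fin_bigcap_measurable => // i _; rewrite -[X in measurable X]setTI.
    exact: measurable_tnth.
  by apply/seteqP; split=> [x Ax i _|x Ax i]; [exact: Ax|exact: (Ax i I)].
rewrite /distribution /pushforward big_ord_recl -IHn// -product_measure1E//.
congr (_ _); apply/seteqP; split=> [[x t] /= Axt|[x t] /= [Ax At] i].
  split; first exact: (Axt ord0).
  by move=> i; have := Axt (lift ord0 i); rewrite tnthS.
case: (unliftP ord0 i) => [j ->|->//].
by rewrite tnthS; exact: At.
Qed.

End iid.

Section model.
Context d (X : measurableType d) (R : realType).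

Definition has_density (nu : {measure set X -> \bar R}) (P : probability X R)
    (p : X -> R) : Prop :=
  [/\ measurable_fun setT p, forall x, 0 <= p x &
      forall A, measurable A -> P A = (\int[nu]_(x in A) (p x)%:E)%E].

Definition hellinger_derivative (nu : {measure set X -> \bar R})
    (p : R -> X -> R) (t : R) (xi : X -> R) : Prop :=
  xi \in Lfun nu 2%:E /\
  ((h ^- 2)%:E * \int[nu]_x ((Num.sqrt (p (t + h) x) - Num.sqrt (p t x)
      - h * xi x) ^+ 2)%:E)%E @[h --> 0^'] --> 0%E.

Definition fisher_info (nu : {measure set X -> \bar R}) (xi : R -> X -> R)
    (t : R) : \bar R :=
  (4%:E * \int[nu]_x ((xi t x) ^+ 2)%:E)%E.

(* Powers with nonpositive base are read as 0 for every exponent (including 0),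
   so that [pospow theta alpha] is [theta ^ alpha] for [0 < theta] and 0 otherwise,
   with derivative [alpha * pospow theta (alpha - 1)] at every [theta != 0]. This
   convention matters where [theta0 > 0]: the indicator of [phi t < theta0 / delta]
   does not force [theta0 + delta * phi t] to be positive. *)
Definition pospow (x a : R) : R := if 0 < x then x `^ a else 0.

Definition minimax_risk (P : R -> probability X R) (psi : R -> R) (n : nat)
    (theta0 delta : R) : \bar R :=
  ereal_inf [set ereal_sup
      [set (\int[iid_law (P theta) n]_x (`|T x - psi theta| ^+ 2)%:E)%E
        | theta in [set theta | `|theta - theta0| < delta]]
    | T in [set T : n.-tuple X -> R | measurable_fun setT T]].

End model.

Section prior.
Context (R : realType).

Definition abs_continuous_on (f : R -> R) (a b : R) : Prop :=
  forall eps, 0 < eps -> exists2 del, 0 < del &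
    forall (m : nat) (u v : 'I_m -> R),
      (forall i, [/\ a <= u i, u i <= v i & v i <= b]) ->
      (forall i j, i != j -> v i <= u j \/ v j <= u i) ->
      \sum_(i < m) (v i - u i) < del ->
      \sum_(i < m) `|f (v i) - f (u i)| < eps.

(* Absolute continuity on the line is understood on compact intervals; for a
   density with finite [location_info] this implies global absolute continuity. *)
Definition ac_density (Q : probability (measurableTypeR R) R) (q : R -> R) : Prop :=
  [/\ forall t, 0 <= q t,
      forall a b, abs_continuous_on q a b &
      forall A, measurable A -> Q A = (\int[lebesgue_measure]_(t in A) (q t)%:E)%E].

(* Fisher information of the location family of [Q]. The absolutely continuous
   density is unique when it exists, so the infimum is over at most one value;
   it is [+oo] when there is none. An absolutely continuous [q] is
   differentiable almost everywhere, so the values of [derive1 q] at other points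
   do not matter. *)
Definition location_info (Q : probability (measurableTypeR R) R) : \bar R :=
  ereal_inf [set (\int[lebesgue_measure]_(t in [set t | (0 < q t)%R])
                    ((derive1 q t) ^+ 2 / q t)%:E)%E
            | q in ac_density Q].

(* A diffeomorphism, here onto ]-1, 1[, is C^1 with C^1 inverse. *)
Definition increasing_diffeo (phi : R -> R) : Prop :=
  [/\ {homo phi : s t / s < t},
      forall t, -1 < phi t < 1,
      (forall t, derivable phi t 1) /\ continuous (derive1 phi) &
      exists g : R -> R,
        [/\ cancel phi g,
            forall y, -1 < y < 1 -> phi (g y) = y &
            forall y, -1 < y < 1 ->
              derivable g y 1 /\ {for y, continuous (derive1 g)}]].

Definition admissible (phi : R -> R) : Prop :=
  [/\ increasing_diffeo phi, phi 0 = 0 &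
      exists C : R, forall t, `|derive1 phi t| < C].

(* With the conventions [+oo^-1 = 0] and [+oo * 0 = 0] on extended reals,
   dividing by this quantity gives [0] when it is infinite. *)
Definition total_info (n : nat) (delta theta0 : R) (I : R -> \bar R)
    (Q : probability (measurableTypeR R) R) (phi : R -> R) : \bar R :=
  (location_info Q + (n%:R * delta ^+ 2)%:E *
     \int[Q]_t (((derive1 phi t) ^+ 2)%:E * I (theta0 + delta * phi t)%R))%E.

End prior.

(* Main.v *)
Require Import Defs.
From HB Require Import structures.
From mathcomp Require Import all_boot all_order all_algebra.
From mathcomp Require Import all_classical all_reals all_analysis.
From mathcomp Require Import measurable_realfun ring lra.

(** The inequality is the van Trees inequality along the curve
    [theta t = theta0 + delta * phi t] with prior [Q] on [t], for the functional
    [Psi t = pospow (theta t) alpha].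

    Let [S] bound the risk of an estimator. Clamping the estimator to the range
    of [Psi] does not increase its risk, so it may be taken bounded; let [m t]
    and [V t] be its mean and variance under the [n]-fold law at [theta t]. The
    bias-variance identity gives [(m - Psi)^2 + V <= S]. Hellinger
    differentiability makes [m] differentiable with
    [m'^2 <= n delta^2 phi'^2 I(theta) V] (the Cramer-Rao bound:
    [hellinger_score_bound] for one observation, [score_bound_iid] for [n]). If
    [q] is the density of [Q], then [(m - Psi) q] vanishes along sequences
    tending to both infinities, and integration by parts gives
    [int q Psi' = int (m - Psi) q' + int q m'].
    Both terms on the right are estimated by [2ab <= a^2 + b^2] with a weight
    [lam]; the squares of [m - Psi] and of [sqrt V] recombine into the risk, so
    [int q Psi' <= lam S / 2 + (I(Q) + int q m'^2 / V) / (2 lam)], and optimizing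
    over [lam] yields [(E_Q Psi')^2 <= S * total_info]. Since [Psi' >= 0], the
    indicators of the three cases only decrease the left-hand side; when
    [theta0 = 0] the factor [delta] is taken out of the power.

    The integration by parts is the delicate point. The density [q] is
    absolutely continuous, but [m] is only differentiable everywhere: nothing
    makes [I(theta)], hence [m'], locally integrable, so the product need not
    be absolutely continuous. What is needed is only an upper bound on an
    increment. [product_increment_le] proves it as one proves that an everywhere
    differentiable function with integrable derivative is the integral of that
    derivative: the expected rate of growth is dominated by a lower
    semicontinuous function with almost the same integral, which controls small
    increments at every point, and a continuity argument chains these together
    ([local_majorization]). At the null set of points where [q] is not
    differentiable the increment of [q] itself is charged to an open set of
    small measure. This uses that [q] is the integral of an integrable function
    ([abs_continuous_integral]): the total variation splits [q] into
    nondecreasing absolutely continuous parts, whose Stieltjes measures are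
    dominated by Lebesgue measure, and the Radon-Nikodym theorem applies.

    Finally [Psi] may fail to be differentiable at the one point where [theta]
    vanishes. The integration by parts is done on both sides of a gap around
    this point, and the gap is closed by the continuity of [(m - Psi) q]. *)

Set Implicit Arguments.
Unset Strict Implicit.
Unset Printing Implicit Defensive.

Import Order.TTheory GRing.Theory Num.Theory.
Import numFieldNormedType.Exports.

Local Open Scope classical_set_scope.
Local Open Scope ring_scope.


(** * Absolute continuity and total variation *)

Section chains.
Context {R : realType}.
Implicit Types (a b x y : R) (s : seq (R * R)) (f F : R -> R).

(** Lists of successive intervals replace indexed families of nonoverlapping
    ones: concatenation and refinement are then list operations. *)
Fixpoint chain a s b : bool :=
  if s is p :: s' then [&& a <= p.1, p.1 <= p.2 & chain p.2 s' b] else a <= b.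

Definition chain_length s : R := \sum_(p <- s) (p.2 - p.1).

Definition chain_variation f s : R := \sum_(p <- s) `|f p.2 - f p.1|.

Definition chain_ac f a b := forall eps, 0 < eps -> exists2 del, 0 < del &
  forall s, chain a s b -> chain_length s < del -> chain_variation f s < eps.

Lemma chain_le a s b : chain a s b -> a <= b.
Proof.
elim: s a => [//|p s IH] a /= /and3P[ap pp /IH].
by apply: le_trans; exact: le_trans pp.
Qed.

Lemma chain_weak a a' s b b' : a' <= a -> b <= b' -> chain a s b -> chain a' s b'.
Proof.
elim: s a a' => [|p s IH] a a' a'a bb' /=.
  by move=> ab; rewrite (le_trans a'a)// (le_trans ab).
by move=> /and3P[ap -> /(IH _ _ (lexx _) bb') ->]; rewrite (le_trans a'a).
Qed.

Lemma chain_cat a s b t c : chain a s b -> chain b t c -> chain a (s ++ t) c.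
Proof.
elim: s a => [|p s IH] a /=; first by move=> ab; exact: chain_weak.
by move=> /and3P[-> -> /IH] /[apply] ->.
Qed.

Lemma chain_nth a s b (i : nat) : chain a s b -> (i < size s)%N ->
  let p := nth (0, 0) s i in [/\ a <= p.1, p.1 <= p.2 & p.2 <= b].
Proof.
elim: s a i => [//|p s IH] a [|i] /= /and3P[ap pp ps] // is_.
  by split=> //; exact: chain_le ps.
have [h1 h2 h3] := IH _ _ ps is_; split=> //.
by rewrite (le_trans ap)// (le_trans pp).
Qed.

Lemma chain_nth_lt a s b (i j : nat) : chain a s b -> (i < j < size s)%N ->
  (nth (0, 0) s i).2 <= (nth (0, 0) s j).1.
Proof.
elim: s a i j => [|p s IH] a i j; first by rewrite ltn0 andbF.
case: i j => [|i] [|j] //=.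
  by move=> /and3P[ap pp ps] js; have [] := chain_nth ps js.
by move=> /and3P[ap pp ps]; exact: IH ps.
Qed.

(** The entries of a chain, indexed by their position, form a nonoverlapping
    family. *)
Lemma abs_continuous_chain_ac f a b : abs_continuous_on f a b -> chain_ac f a b.
Proof.
move=> acf e e0; have [del del0 H] := acf e e0; exists del => // s cs sdel.
have S (F : R * R -> R) : \sum_(p <- s) F p =
    \sum_(i < size s) F (nth (0, 0) s i) by rewrite (big_nth (0, 0)) big_mkord.
rewrite /chain_variation S.
apply: (H _ (fun i => (nth (0, 0) s i).1) (fun i => (nth (0, 0) s i).2)).
- by move=> i; exact: chain_nth cs (ltn_ord i).
- move=> i j; rewrite -val_eqE neq_ltn => /orP[ij|ji]; [left|right];
  by apply: chain_nth_lt cs _; rewrite ?ij ?ji ltn_ord.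
- by move: sdel; rewrite /chain_length S.
Qed.

Lemma chain_variation_cat f s t :
  chain_variation f (s ++ t) = chain_variation f s + chain_variation f t.
Proof. by rewrite /chain_variation big_cat. Qed.

Lemma chain_length_cat s t :
  chain_length (s ++ t) = chain_length s + chain_length t.
Proof. by rewrite /chain_length big_cat. Qed.

Definition partition_chain x (l : seq R) : seq (R * R) :=
  [seq (p.2, p.1) | p <- zip l (x :: l)].

Lemma partition_chainP f x y l : itv_partition x y l ->
  [/\ chain x (partition_chain x l) y,
      chain_length (partition_chain x l) = y - x &
      chain_variation f (partition_chain x l) = variation x y f l].
Proof.
move=> pl; split; last first.
- rewrite variation_zip// /chain_variation /partition_chain big_map.
  by apply: eq_bigr.
- elim: l x pl => [|z l IH] x pl.
    by rewrite /chain_length big_nil (itv_partition_nil pl) subrr.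
  rewrite /chain_length /= big_cons /=.
  have /IH := itv_partition_cons pl; rewrite /chain_length /partition_chain => ->.
  by rewrite addrC subrKA.
- elim: l x pl => [|z l IH] x pl /=; first by rewrite (itv_partition_nil pl).
  have /IH := itv_partition_cons pl; rewrite /partition_chain => ->.
  by case: pl => /= /andP[/ltW -> _] _; rewrite lexx.
Qed.

(** On an interval shorter than the modulus for [eps = 1] every partition is a
    chain, so the variation is at most 1; finitely many such intervals cover. *)
Lemma chain_ac_bounded_variation f a b : a <= b -> chain_ac f a b ->
  bounded_variation a b f.
Proof.
move=> ab acf; have [del del0 H] := acf 1 ltr01.
have short x y : a <= x -> x <= y -> y <= b -> y - x < del ->
    total_variation x y f \is a fin_num.
  move=> ax xy yb yx; apply/bounded_variationP => //; exists 1 => _ [l pl <-].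
  have [c1 c2 <-] := partition_chainP f pl; apply/ltW/H; last by rewrite c2.
  exact: chain_weak c1.
have step (k : nat) : forall x y, a <= x -> x <= y -> y <= b ->
    y - x < k%:R * (del / 2) -> total_variation x y f \is a fin_num.
  elim: k => [|k IH] x y ax xy yb; first by rewrite mul0r; lra.
  have [yx _|yx] := ltP (y - x) del; first exact: short.
  rewrite -natr1 mulrDl mul1r => yxk.
  rewrite (total_variationD f (_ : x <= x + del / 2) (_ : _ <= y)); [|lra..].
  rewrite fin_numD short//=; [|lra..].
  by apply: IH => //; lra.
apply/bounded_variationP => //.
apply: (step (Num.truncn ((b - a) / (del / 2))).+1) => //.
rewrite -ltr_pdivrMr ?divr_gt0//.
have /truncn_itv /andP[_ //] : 0 <= (b - a) / (del / 2).
by rewrite divr_ge0 ?subr_ge0// ltW// divr_gt0.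
Qed.

(** The variation function: [tv a f] and [tv a f - f] are nondecreasing with
    difference [f], which is the Jordan decomposition. *)
Definition tv a f x : R := fine (total_variation a x f).

Section tv.
Variables (f : R -> R) (a b : R).
Hypotheses (ab : a <= b) (acf : chain_ac f a b).

Let tv_fin x y : a <= x -> x <= y -> y <= b -> total_variation x y f \is a fin_num.
Proof.
move=> ax xy yb; apply/bounded_variationP => //.
apply: (bounded_variationr ax) => //.
by apply: (bounded_variationl _ yb); [exact: le_trans xy|
  exact: chain_ac_bounded_variation].
Qed.

Lemma tvB x y : a <= x -> x <= y -> y <= b ->
  tv a f y - tv a f x = fine (total_variation x y f).
Proof.
move=> ax xy yb; rewrite /tv (total_variationD f ax xy) fineD ?tv_fin//.
  by rewrite addrAC subrr add0r.
exact: le_trans xy yb.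
Qed.

Lemma normB_le_tvB x y : a <= x -> x <= y -> y <= b ->
  `|f y - f x| <= tv a f y - tv a f x.
Proof.
move=> ax xy yb; rewrite tvB// -lee_fin fineK ?tv_fin//.
exact: total_variation_ge.
Qed.

(** Each interval is replaced by a partition whose variation of [f] is nearly the
    total variation there. The total length is unchanged, which is what
    transfers the modulus of absolute continuity from [f] to [tv a f]. *)
Lemma refine_chain s x eta : 0 < eta -> a <= x -> chain x s b ->
  exists s', [/\ chain x s' b, chain_length s' = chain_length s &
    chain_variation (tv a f) s <= chain_variation f s' + (size s)%:R * eta].
Proof.
move=> eta0; elim: s x => [|[u v] s IH] x ax /=.
  move=> xb; exists [::]; split=> //.
  by rewrite /chain_variation !big_nil mul0r addr0.
move=> /and3P[/= xu uv vs].
have au : a <= u := le_trans ax xu.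
have vb : v <= b := chain_le vs.
have [s' [c1 c2 c3]] := IH v (le_trans au uv) vs.
have [l pl lv] : exists2 l, itv_partition u v l &
    fine (total_variation u v f) - eta < variation u v f l.
  have := @ub_ereal_sup_adherent _ _ _ eta0 (tv_fin au uv vb).
  move=> [_ [_ [l pl <-] <-]]; rewrite -/(total_variation u v f) => h.
  by exists l => //; rewrite -lte_fin EFinB fineK// tv_fin.
have [d1 d2 d3] := partition_chainP f pl.
exists (partition_chain u l ++ s'); split.
- by apply: (chain_weak xu (lexx b)); exact: chain_cat d1 c1.
- by rewrite chain_length_cat d2 c2 /chain_length big_cons.
- rewrite chain_variation_cat d3 /chain_variation big_cons /=.
  rewrite ger0_norm; last by apply: le_trans (normB_le_tvB au uv vb).
  rewrite tvB// -natr1 mulrDl mul1r.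
  move: c3; rewrite /chain_variation; lra.
Qed.

Lemma chain_ac_tv : chain_ac (tv a f) a b.
Proof.
move=> e e0; have e20 : 0 < e / 2 by lra.
have [del del0 H] := acf e20; exists del => // s cs sl.
(* The loss [eta] on each interval of the chain adds up to at most [e / 2]. *)
pose eta := e / 2 / (size s).+1%:R.
have eta0 : 0 < eta by rewrite divr_gt0.
have [s' [c1 c2 c3]] := refine_chain eta0 (lexx _) cs.
apply: (le_lt_trans c3).
have := H _ c1; rewrite c2 => /(_ sl) h.
have : (size s)%:R * eta <= e / 2.
  rewrite /eta mulrCA ler_piMr//; first exact: ltW.
  by rewrite ler_pdivrMr// mul1r ler_nat.
lra.
Qed.

End tv.

Lemma chain_acB f F a b : chain_ac f a b -> chain_ac F a b ->
  chain_ac (fun x => f x - F x) a b.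
Proof.
move=> cf cF e e0; have e20 : 0 < e / 2 by lra.
have [d1 d10 H1] := cf _ e20; have [d2 d20 H2] := cF _ e20.
exists (Num.min d1 d2); first by rewrite lt_min d10.
move=> s cs; rewrite lt_min => /andP[s1 s2].
have h1 := H1 _ cs s1; have h2 := H2 _ cs s2.
rewrite (splitr e); apply: le_lt_trans (ltrD h1 h2).
rewrite /chain_variation -big_split; apply: ler_sum => p _ /=.
have -> : f p.2 - F p.2 - (f p.1 - F p.1) = f p.2 - f p.1 - (F p.2 - F p.1).
  by ring.
exact: ler_normB.
Qed.

End chains.

(** * Absolutely continuous functions are integrals of integrable functions *)

Section stieltjes.
Context {R : realType}.
Implicit Types (a b x y : R) (F : R -> R).
Local Notation mu := (@lebesgue_measure R).

Definition clamp a b x := Num.max a (Num.min x b).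

Lemma clamp_itv a b x : a <= b -> a <= clamp a b x <= b.
Proof. by move=> ab; rewrite /clamp le_max lexx /= ge_max ab ge_min lexx orbT. Qed.

Lemma clamp_id a b x : a <= x <= b -> clamp a b x = x.
Proof. by move=> /andP[ax xb]; rewrite /clamp (min_idPl xb) (max_idPr ax). Qed.

Lemma clamp_le a b x y : x <= y -> clamp a b x <= clamp a b y.
Proof.
move=> xy; rewrite /clamp ge_max !le_max lexx /= !le_min !ge_min xy lexx.
by rewrite !orbT.
Qed.

Lemma clampB a b x y : a <= b -> x <= y -> clamp a b y - clamp a b x <= y - x.
Proof.
move=> ab xy; rewrite /clamp.
have : Num.min x b <= Num.min y b <= Num.min x b + (y - x).
  by case: (leP y b) => h1; case: (leP x b) => h2; apply/andP; split; lra.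
move: (Num.min x b) (Num.min y b) => u v /andP[uv vu].
by case: (leP a u) => h1; case: (leP a v) => h2; lra.
Qed.

Lemma lebesgue_stieltjes_itv (f : cumulative R R) x y : x <= y ->
  lebesgue_stieltjes_measure f `]x, y] = (f y - f x)%:E.
Proof.
move=> xy; rewrite /lebesgue_stieltjes_measure /measure_extension/=.
by rewrite measurable_mu_extE/= ?wlength_itv_bnd//; exact: is_ocitv.
Qed.

Lemma dist_in_cell (u l r x y : R) : l < r -> u <= x <= u + l ->
  u <= y <= u + l -> `|x - y| < r.
Proof.
move=> lr /andP[ux xu] /andP[uy yu].
by rewrite ltr_norml; apply/andP; split; lra.
Qed.

Section monotone_ac.
Variables (F : R -> R) (a b : R).
Hypotheses (ab : a < b) (ndF : forall x y, a <= x -> x <= y -> y <= b -> F x <= F y).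
Hypothesis acF : chain_ac F a b.

(** [F] is extended by constants beyond [a] and [b] so that it defines a
    Stieltjes measure on the line. *)
Let G x := F (clamp a b x).

Let ndG : nondecreasing G.
Proof.
move=> x y xy; rewrite /G; have /andP[h1 h2] := clamp_itv x (ltW ab).
by have /andP[h3 h4] := clamp_itv y (ltW ab); apply: ndF => //; exact: clamp_le.
Qed.

Let GE x : a <= x <= b -> G x = F x.
Proof. by move=> /clamp_id; rewrite /G => ->. Qed.

Lemma stieltjes_right_continuous : right_continuous G.
Proof.
move=> x; apply/cvgrPdist_lt => e e0.
have [del del0 H] := acF e0; near=> y.
have xy : x < y by near: y; exact: nbhs_right_gt.
have yx : y - x < del.
  by rewrite ltrBlDl; near: y; apply: nbhs_right_lt; rewrite ltrDl.
have := H [:: (clamp a b x, clamp a b y)].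
rewrite /chain_length /chain_variation !big_seq1 /= distrC; apply.
  have /andP[-> _] := clamp_itv x (ltW ab).
  by have /andP[_ ->] := clamp_itv y (ltW ab); rewrite clamp_le// ltW.
by apply: le_lt_trans yx; apply: clampB; apply: ltW.
Unshelve. all: by end_near. Qed.

Definition stieltjes_cumulative : cumulative R R :=
  HB.pack G (isCumulative.Build _ _ _ G ndG stieltjes_right_continuous).

Local Notation nu := (lebesgue_stieltjes_measure stieltjes_cumulative).

Lemma stieltjes_itv x y : x <= y -> nu `]x, y] = (G y - G x)%:E.
Proof. exact: lebesgue_stieltjes_itv. Qed.

Lemma stieltjes_le A : measurable A -> (nu A <= (F b - F a)%:E)%E.
Proof.
move=> mA; apply: (@le_trans _ _ (nu setT)).
  by apply: le_measure => //; rewrite inE//; exact: measurableT.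
pose I n : set (measurableTypeR R) := `](- n%:R), (n%:R : R)]%classic.
have cI : nu (I n) @[n --> \oo] --> nu (\bigcup_n I n).
  apply: nondecreasing_cvg_mu.
  - by move=> n; exact: measurable_itv.
  - by apply: bigcup_measurable => n _; exact: measurable_itv.
  - by move=> n m nm; apply/subsetPset/subset_itv; rewrite bnd_simp ?lerN2 ler_nat.
rewrite -(bigcup_itvT false false).
apply: (cvge_to_le cI); near=> n.
rewrite stieltjes_itv ?lee_fin; last by rewrite -subr_ge0 opprK addr_ge0.
have /andP[h1 h2] := clamp_itv n%:R (ltW ab).
have /andP[h3 h4] := clamp_itv (- n%:R) (ltW ab).
by apply: lerB; apply: ndF.
Unshelve. all: by end_near. Qed.

Lemma stieltjes_fin : fin_num_fun nu.
Proof.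
by move=> A mA; rewrite ge0_fin_numE// (le_lt_trans (stieltjes_le mA))// ltry.
Qed.

(** The measure is renamed to carry its finiteness, which the Radon-Nikodym
    theorem asks for. *)
Definition stieltjes_finite : set (measurableTypeR R) -> \bar R := nu.

HB.instance Definition _ := Measure.on stieltjes_finite.

HB.instance Definition _ :=
  Measure_isFinite.Build _ _ _ stieltjes_finite stieltjes_fin.

(** The end points of the division of [a, b] into [n + 1] equal cells. The cells
    contained in an open set exhaust it as [n] grows, and finitely many
    disjoint cells form a chain, which is how absolute continuity meets open
    sets. *)
Let c (n j : nat) : R := a + (b - a) * (j%:R / n.+1%:R).

Let c_le n i j : (i <= j)%N -> c n i <= c n j.
Proof.
move=> ij; rewrite /c lerD2l ler_wpM2l//; first by rewrite subr_ge0 ltW.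
by rewrite ler_wpM2r ?invr_ge0// ler_nat.
Qed.

Let c_itv n j : (j <= n.+1)%N -> a <= c n j <= b.
Proof.
move=> jn; have /andP[t0 t1] : 0 <= (j%:R / n.+1%:R : R) <= 1.
  by rewrite divr_ge0//= ler_pdivrMr// mul1r ler_nat.
have ba : 0 <= b - a by rewrite subr_ge0 ltW.
rewrite /c lerDl mulr_ge0//= -lerBrDl.
by rewrite -[leRHS]mulr1 ler_wpM2l.
Qed.

Let cells (U : set R) n (j : nat) : bool := `[< `[c n j, c n j.+1] `<=` U >].

Let cell_chain U n (s : seq nat) x k :
  (forall i, (i \in s) -> (k <= i)%N) -> sorted ltn s -> x <= c n k ->
  (forall i, i \in s -> (i <= n)%N) -> (k <= n.+1)%N ->
  chain x [seq (c n j, c n j.+1) | j <- s & cells U n j] b.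
Proof.
elim: s x k => [|j s IH] x k ks ss xk sn kn.
  by apply: (le_trans xk); have /andP[] := c_itv kn.
have kj : (k <= j)%N by apply: ks; rewrite mem_head.
have jn : (j <= n)%N by apply: sn; rewrite mem_head.
have rest y : y <= c n j.+1 ->
    chain y [seq (c n j, c n j.+1) | j <- s & cells U n j] b.
  move=> yj; apply: (IH _ j.+1) => //.
  - move=> i is_; move: ss; rewrite /= (path_sortedE ltn_trans) => /andP[/allP + _].
    exact.
  - exact: path_sorted ss.
  - by move=> i is_; apply: sn; rewrite inE is_ orbT.
rewrite /=; case: ifP => _ /=.
  apply/and3P; split; [|exact: c_le|exact: rest].
  by apply: (le_trans xk); exact: c_le.
by apply: rest; rewrite (le_trans xk)// c_le// (leq_trans kj).
Qed.

Let inner_cells (U : set R) n : set (measurableTypeR R) :=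
  \big[setU/set0]_(j < n.+1 | cells U n j) `]c n j, c n j.+1]%classic.

Let measurable_inner_cells U n : measurable (inner_cells U n).
Proof. by apply: bigsetU_measurable => i _; exact: measurable_itv. Qed.

Let inner_cells_measure (m : {measure set (measurableTypeR R) -> \bar R}) U n :
  m (inner_cells U n) = (\sum_(j < n.+1 | cells U n j) m `]c n j, c n j.+1]%classic)%E.
Proof.
rewrite /inner_cells measure_bigsetU_ord_cond//.
apply/trivIsetP => i j _ _ ij; rewrite -subset0 => x /=.
  rewrite !in_itv/= => -[/andP[h1 h2] /andP[h3 h4]].
  move: ij; rewrite -val_eqE neq_ltn => /orP[] /(c_le n) h.
  + by have := lt_le_trans h3 (le_trans h2 h); rewrite ltxx.
  + by have := lt_le_trans h1 (le_trans h4 h); rewrite ltxx.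
Qed.

Let inner_cells_sub U n : inner_cells U n `<=` U.
Proof.
rewrite /inner_cells; elim/big_ind : _ => //.
  by move=> A B AU BU x [/AU|/BU].
move=> i /asboolP iU x xi; apply: iU.
by move: x xi; apply: subset_itv; rewrite bnd_simp.
Qed.

Let sum_cells U n (h : nat -> R) :
  \sum_(p <- [seq j <- iota 0 n.+1 | cells U n j]) h p =
  \sum_(j < n.+1 | cells U n j) h j.
Proof.
by rewrite big_filter (_ : iota 0 n.+1 = index_iota 0 n.+1) ?big_mkord//.
Qed.

Let inner_cells_small U del e : measurable (U : set (measurableTypeR R)) ->
  (forall s, chain a s b -> chain_length s < del -> chain_variation F s < e) ->
  (mu U < del%:E)%E -> forall n, (nu (inner_cells U n) <= e%:E)%E.
Proof.
move=> mU H Ud n.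
pose s := [seq (c n j, c n j.+1) | j <- iota 0 n.+1 & cells U n j].
have cs : chain a s b.
  apply: (@cell_chain _ _ _ _ 0%N) => //; first exact: iota_ltn_sorted.
  - by have /andP[] := @c_itv n 0%N erefl.
  - by move=> i; rewrite mem_iota add0n ltnS.
have ls : chain_length s < del.
  rewrite /chain_length /s big_map sum_cells/= -lte_fin.
  apply: le_lt_trans Ud; apply: (@le_trans _ _ (mu (inner_cells U n))); last first.
    by apply: le_measure; rewrite ?inE//; exact: inner_cells_sub.
  rewrite inner_cells_measure -sumEFin le_eqVlt; apply/orP; left; apply/eqP.
  apply: eq_bigr => j _; have := lebesgue_measure_itv `]c n j, c n j.+1].
  rewrite /= lte_fin => ->; case: ltP => // h.
  by congr EFin; apply/eqP; rewrite subr_eq0 eq_le h c_le.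
rewrite inner_cells_measure.
have := H s cs ls.
rewrite /chain_variation /s big_map sum_cells/= -lte_fin => /ltW.
apply: le_trans; rewrite -sumEFin; apply: lee_sum => j _.
rewrite stieltjes_itv ?c_le// lee_fin !GE ?c_itv ?ler_norm//.
exact: ltnW (ltn_ord j).
Qed.

(** A point of an open set has a ball inside it, and the cell of the point fits in
    this ball as soon as the mesh is less than the radius. *)
Let inner_cells_near U x : open U -> U x -> a < x <= b ->
  exists m, forall n, (m <= n)%N -> inner_cells U n x.
Proof.
move=> oU Ux /andP[ax xb].
have /nbhs_ballP[r /= r0 rU] : nbhs x U by exact: open_nbhs_nbhs.
exists (Num.truncn ((b - a) / r)) => n mn.
have nr : (b - a) / n.+1%:R < r.
  rewrite ltr_pdivrMr// mulrC -ltr_pdivrMr//.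
  have /truncn_itv /andP[_] : 0 <= (b - a) / r.
    by rewrite divr_ge0 ?subr_ge0// ltW.
  by move=> /lt_le_trans; apply; rewrite ler_nat ltnS.
have cb : c n n.+1 = b by rewrite /c divff ?mulr1 ?subrKC.
have ca : c n 0 = a by rewrite /c mul0r mulr0 addr0.
have ex : exists k, x <= c n k by exists n.+1; rewrite cb.
have [k xk km] := ex_minnP ex.
have k0 : (0 < k)%N.
  by rewrite lt0n; apply/eqP => k0; move: xk; rewrite k0 ca leNgt ax.
have xk1 : c n k.-1 < x.
  by rewrite ltNge; apply/negP => /km; rewrite leqNgt prednK// leqnn.
have kn : (k.-1 < n.+1)%N by rewrite prednK//; apply: km; rewrite cb.
rewrite /inner_cells (bigD1 (Ordinal kn))/=; last first.
  apply/asboolP => y /=; rewrite in_itv/= => /andP[h1 h2]; apply: rU.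
  have ck : c n k.-1.+1 = c n k.-1 + (b - a) / n.+1%:R.
    by rewrite /c -[k.-1.+1%:R]natr1 [(_ + 1) / _]mulrDl mul1r mulrDr addrA.
  apply: (dist_in_cell nr (u := c n k.-1)); rewrite -ck ?h1//.
  by rewrite (ltW xk1) prednK.
by left; rewrite /= in_itv/= xk1 prednK.
Qed.

Let nuC : nu (~` `]a, b]) = 0%E.
Proof.
have mab : measurable (`]a, b] : set (measurableTypeR R)) by exact: measurable_itv.
have h : nu `]a, b]%classic = (F b - F a)%:E.
  by rewrite stieltjes_itv ?ltW// !GE ?lexx ?ltW.
have -> : nu (~` `]a, b]) = (nu setT - nu `]a, b]%classic)%E.
  rewrite -setTD measureD//; first by congr (_ - nu _)%E; rewrite setTI.
  exact: le_lt_trans (stieltjes_le measurableT) (ltry _).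
rewrite h; apply/eqP; rewrite eq_le; apply/andP; split.
  by rewrite sube_le0 stieltjes_le.
by rewrite sube_ge0// -h le_measure// inE.
Qed.

(** A null set lies in an open set of small measure. The cells inside this open set
    have small total length, hence small Stieltjes measure by absolute
    continuity, and they fill up the part of the open set in ]a, b]. *)
Lemma stieltjes_dominated : nu `<< mu.
Proof.
apply/null_content_dominatesP => A mA A0.
apply/eqP; rewrite eq_le measure_ge0 andbT; apply/lee_addgt0Pr => e e0.
rewrite add0e; have [del del0 H] := acF e0.
have Afin : (mu A < +oo)%E by rewrite A0.
have [U [oU AU Ud]] := lebesgue_regularity_outer mA Afin del0.
have mU : measurable (U : set (measurableTypeR R)) by exact: open_measurable.
have {}Ud : (mu U < del%:E)%E.
  rewrite (measureDI mu mU mA) [X in (_ + X)%E](_ : _ = 0%E) ?adde0//.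
  by apply/eqP; rewrite eq_le measure_ge0 andbT -A0 le_measure// inE//; exact: measurableI.
pose W m : set (measurableTypeR R) := \bigcap_(n in [set n | (m <= n)%N]) inner_cells U n.
have mW m : measurable (W m) by apply: bigcap_measurable => //; exists m => /=.
have cW : nu (W n) @[n --> \oo] --> nu (\bigcup_n W n).
  apply: nondecreasing_cvg_mu => //.
    exact: bigcup_measurable.
  move=> n m nm; apply/subsetPset => x Wx k /= mk; apply: Wx => /=.
  exact: leq_trans mk.
have We : (nu (\bigcup_n W n) <= e%:E)%E.
  apply: (cvge_to_le cW); near=> n.
  apply: le_trans (inner_cells_small mU H Ud n); apply: le_measure; rewrite ?inE//.
  by move=> x; apply => /=.
apply: (@le_trans _ _ (nu ((\bigcup_n W n) `|` ~` `]a, b]))).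
  apply: le_measure; rewrite ?inE//.
    apply: measurableU; first exact: bigcup_measurable.
    by apply: measurableC; exact: measurable_itv.
  move=> x Ax; have [xab|] := pselect (`]a, b]%classic x); last by right.
  left; have [m mx] := inner_cells_near oU (AU _ Ax) xab.
  by exists m.
apply: (le_trans (measureU2 _ _ _)).
- exact: bigcup_measurable.
- by apply: measurableC; exact: measurable_itv.
- rewrite -[leRHS]adde0; apply: leeD => //.
  by rewrite le_eqVlt; apply/orP; left; apply/eqP; exact: nuC.
Unshelve. all: by end_near. Qed.

Lemma monotone_ac_integral : exists g : R -> R,
  mu.-integrable setT (EFin \o g) /\
  forall x y, a <= x -> x <= y -> y <= b ->
    F y - F x = \int[mu]_(t in `]x, y]) g t.
Proof.
have [f [f0 ffin fi fE]] := @radon_nikodym_sigma_finite _ _ _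
  mu stieltjes_finite stieltjes_dominated.
have fF : f = EFin \o (fine \o f) by apply/funext => x; rewrite /= fineK.
exists (fine \o f); split; first by rewrite -fF.
move=> x y ax xy yb.
have E : (\int[mu]_(t in `]x, y]) f t = (F y - F x)%:E)%E.
  rewrite -fE; last exact: measurable_itv.
  apply: etrans (stieltjes_itv xy) _; rewrite !GE//.
    by rewrite ax (le_trans xy).
  by rewrite (le_trans ax).
rewrite /Rintegral (_ : (\int[mu]_(t in _) _)%E = (F y - F x)%:E)//.
by rewrite -E; apply: eq_integral => t _; rewrite /= fineK.
Qed.

End monotone_ac.

(** The Jordan decomposition reduces to nondecreasing functions. *)
Theorem abs_continuous_integral (f : R -> R) a b : a < b ->
  abs_continuous_on f a b -> exists g : R -> R,
  mu.-integrable setT (EFin \o g) /\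
  forall x y, a <= x -> x <= y -> y <= b ->
    f y - f x = \int[mu]_(t in `]x, y]) g t.
Proof.
move=> ab /abs_continuous_chain_ac acf.
have actv := chain_ac_tv (ltW ab) acf.
have tvf := normB_le_tvB (ltW ab) acf.
have ndtv x y : a <= x -> x <= y -> y <= b -> tv a f x <= tv a f y.
  move=> ax xy yb; rewrite -subr_ge0; exact: le_trans (tvf _ _ ax xy yb).
have ndd x y : a <= x -> x <= y -> y <= b -> tv a f x - f x <= tv a f y - f y.
  move=> ax xy yb; have := tvf _ _ ax xy yb; rewrite ler_norml => /andP[_]; lra.
have [g1 [ig1 g1E]] := monotone_ac_integral ab ndtv actv.
have [g2 [ig2 g2E]] := monotone_ac_integral ab ndd (chain_acB actv acf).
exists (g1 \- g2); split.
  rewrite (_ : EFin \o _ = (EFin \o g1) \- (EFin \o g2))%E//.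
  exact: integrableB.
move=> x y ax xy yb; rewrite RintegralB//; last 2 first.
- exact: integrableS ig1.
- exact: integrableS ig2.
by rewrite -g1E// -g2E//; lra.
Qed.

(** Lebesgue differentiation, in the form of the first fundamental theorem. *)
Theorem abs_continuous_derivable (f g : R -> R) a b :
  mu.-integrable setT (EFin \o g) ->
  (forall x y, a <= x -> x <= y -> y <= b ->
    f y - f x = \int[mu]_(t in `]x, y]) g t) ->
  {ae mu, forall x, a < x < b -> derivable f x 1 /\ derive1 f x = g x}.
Proof.
move=> ig fE.
have := @FTC1 R g (BRight a) _ _.
have h1 (y : R) : mu.-integrable `]a, y] (EFin \o g) by exact: integrableS ig.
have h2 : locally_integrable [set: R] g.
  by rewrite -(patch_setT (cst 0) g); exact: integrable_locally.
move=> /(_ h1 h2); apply: filterS; first exact: (ae_filter_ringOfSetsType mu).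
move=> x H /andP[ax xb].
have [] := H ax; set F := (fun y => _) => dF F'x.
have fF : \near x, f a + F x = f x.
  near=> y; rewrite -(subrKC (f a) (f y)) fE//.
  - by apply: ltW; near: y; exact: lt_nbhsr.
  - by apply: ltW; near: y; exact: lt_nbhsl.
have isF : is_derive x 1 F (g x).
  by apply: DeriveDef => //; rewrite -derive1E.
have isf : is_derive x 1 f (g x).
  apply: (near_eq_is_derive fF); rewrite -[g x]add0r.
  exact: is_deriveD.
by split; rewrite ?derive1E ?derive_val.
Unshelve. all: by end_near. Qed.

End stieltjes.

(** * Expectation and variance of bounded statistics *)

Section bounded_tests.
Context d (X : measurableType d) (R : realType).
Implicit Types (P : probability X R) (T : X -> R) (c : R).

(** Bounded statistics are enough, since estimators are clamped, and they make all
    expectations finite. *)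
Definition test_fun T c := measurable_fun setT T /\ forall x, `|T x| <= c.

Definition expec P T : R := \int[P]_x T x.

Definition var P T : R := expec P (fun x => T x ^+ 2) - expec P T ^+ 2.

Lemma test_ge0 T c : test_fun T c -> forall x : X, 0 <= c.
Proof. by move=> [_ h] x; exact: le_trans (h x). Qed.

Lemma test_integrable P T c : test_fun T c -> P.-integrable setT (EFin \o T).
Proof.
move=> [mT bT]; apply: measurable_bounded_integrable => //.
  by rewrite (le_lt_trans (probability_le1 _ _))// ltry.
exists c; split; first exact: num_real.
by move=> y cy x _ /=; rewrite (le_trans (bT x))// ltW.
Qed.

Lemma test_cst r : test_fun (cst r) `|r|.
Proof. by split => //; exact: measurable_cst. Qed.

Lemma testD T U c k : test_fun T c -> test_fun U k ->
  test_fun (fun x => T x + U x) (c + k).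
Proof.
move=> [mT bT] [mU bU]; split; first exact: measurable_funD.
by move=> x; rewrite (le_trans (ler_normD _ _))// lerD.
Qed.

Lemma testN T c : test_fun T c -> test_fun (fun x => - T x) c.
Proof.
by move=> [mT bT]; split; [exact: measurableT_comp|move=> x; rewrite normrN].
Qed.

Lemma testM T U c k : test_fun T c -> test_fun U k ->
  test_fun (fun x => T x * U x) (c * k).
Proof.
move=> [mT bT] [mU bU]; split; first exact: measurable_funM.
by move=> x; rewrite normrM ler_pM.
Qed.

Lemma testX2 T c : test_fun T c -> test_fun (fun x => T x ^+ 2) (c ^+ 2).
Proof. by move=> h; under eq_fun do rewrite expr2; exact: testM. Qed.

Lemma expecD P T U c k : test_fun T c -> test_fun U k ->
  expec P (fun x => T x + U x) = expec P T + expec P U.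
Proof.
move=> hT hU; rewrite /expec RintegralD//; first exact: test_integrable hT.
exact: test_integrable hU.
Qed.

Lemma expecB P T U c k : test_fun T c -> test_fun U k ->
  expec P (fun x => T x - U x) = expec P T - expec P U.
Proof.
move=> hT hU; rewrite /expec RintegralB//; first exact: test_integrable hT.
exact: test_integrable hU.
Qed.

Lemma expecZ P T c r : test_fun T c ->
  expec P (fun x => r * T x) = r * expec P T.
Proof. by move=> hT; rewrite /expec RintegralZl//; exact: test_integrable hT. Qed.

Lemma expec_cst P r : expec P (cst r) = r.
Proof. by rewrite /expec Rintegral_cst//= probability_setT mulr1. Qed.

Lemma expec_lin P r T U c k : test_fun T c -> test_fun U k ->
  expec P (fun x => r * T x + U x) = r * expec P T + expec P U.
Proof.
by move=> hT hU; rewrite (expecD _ (testM (test_cst r) hT) hU) (expecZ _ _ hT).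
Qed.

Lemma le_expec P T U c k : test_fun T c -> test_fun U k ->
  (forall x, T x <= U x) -> expec P T <= expec P U.
Proof.
move=> hT hU TU; apply: le_Rintegral => //; first exact: test_integrable hT.
exact: test_integrable hU.
Qed.

Lemma norm_expec P T c : test_fun T c -> `|expec P T| <= c.
Proof.
move=> hT; have Tc x : - c <= T x <= c by rewrite -ler_norml; exact: hT.2.
rewrite ler_norml; apply/andP; split.
- rewrite -(expec_cst P (- c)); apply: (le_expec _ (test_cst _) hT) => x.
  by have /andP[] := Tc x.
- rewrite -[leRHS](expec_cst P c); apply: (le_expec _ hT (test_cst _)) => x.
  by have /andP[] := Tc x.
Qed.

Lemma var_center P T c : test_fun T c ->
  expec P (fun x => (T x - expec P T) ^+ 2) = var P T.
Proof.
move=> hT; set m := expec P T.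
have -> : (fun x => (T x - m) ^+ 2) = (fun x => T x ^+ 2 + (- (m *+ 2) * T x + m ^+ 2)).
  by apply/funext => x; ring.
rewrite (@expecD _ _ _ (c ^+ 2) (`|- (m *+ 2)| * c + `|m ^+ 2|)); last 2 first.
- exact: testX2.
- by apply: testD; [apply: testM => //; exact: test_cst|exact: test_cst].
rewrite (@expecD _ _ _ (`|- (m *+ 2)| * c) (`|m ^+ 2|)); last 2 first.
- by apply: testM => //; exact: test_cst.
- exact: test_cst.
rewrite (expecZ _ _ hT) expec_cst /var -/m; ring.
Qed.

Lemma var_ge0 P T c : test_fun T c -> 0 <= var P T.
Proof.
move=> hT; rewrite -(var_center P hT).
by apply: Rintegral_ge0 => x _; exact: sqr_ge0.
Qed.

End bounded_tests.
Arguments test_cst {d X R} r.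

(** * Information bounds for bounded statistics *)

Section score_bound.
Context d (X : measurableType d) (R : realType).

(** What remains of Fisher information [J] once scores are forgotten. The first
    part is the Cramer-Rao bound. The second, a Lipschitz bound in total
    variation uniform over statistics, is what lets two factors of a product
    move at the same time: the mixed increment is then quadratic. *)
Definition score_bound (P : R -> probability X R) (t J : R) : Prop :=
  (forall (T : X -> R) (c : R), test_fun T c ->
     exists2 D, is_derive t 1 (fun s => expec (P s) T) D &
                D ^+ 2 <= J * var (P t) T) /\
  exists2 C, 0 <= C & \forall s \near t, forall (T : X -> R) (c : R),
     test_fun T c -> `|expec (P s) T - expec (P t) T| <= c * (C * `|s - t|).

End score_bound.

(** * Product measures *)

Section product.
Context d1 d2 (X : measurableType d1) (Y : measurableType d2) (R : realType).
Implicit Types (P : probability X R) (Q : probability Y R) (T : X * Y -> R).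

Lemma test_section1 T c x : test_fun T c -> test_fun (fun y => T (x, y)) c.
Proof.
move=> [mT bT]; split=> //.
by apply: (measurableT_comp mT); exact: pair1_measurable.
Qed.

Lemma test_section2 T c y : test_fun T c -> test_fun (fun x => T (x, y)) c.
Proof.
move=> [mT bT]; split=> //.
by apply: (measurableT_comp mT); exact: pair2_measurable.
Qed.

Lemma test_marginal1 P Q T c : test_fun T c ->
  test_fun (fun x => expec Q (fun y => T (x, y))) c.
Proof.
move=> hT; split; last by move=> x; apply: norm_expec; exact: test_section1.
apply: (measurableT_comp (f := fine) (g := fubini_F Q (EFin \o T))) => //.
apply: (@measurable_fubini_F _ _ _ _ _ P Q (EFin \o T)).
exact: test_integrable hT.
Qed.

Lemma test_marginal2 P Q T c : test_fun T c ->
  test_fun (fun y => expec P (fun x => T (x, y))) c.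
Proof.
move=> hT; split; last by move=> y; apply: norm_expec; exact: test_section2.
apply: (measurableT_comp (f := fine) (g := fubini_G P (EFin \o T))) => //.
apply: (@measurable_fubini_G _ _ _ _ _ P Q (EFin \o T)).
exact: test_integrable hT.
Qed.

Lemma expec_prod1 P Q T c : test_fun T c ->
  expec (P \x Q)%E T = expec P (fun x => expec Q (fun y => T (x, y))).
Proof.
move=> hT; rewrite /expec /Rintegral -integral12_prod_meas1.
  congr fine; apply: eq_integral => x _; rewrite fineK//.
  by apply: integrable_fin_num => //; exact: test_integrable (test_section1 x hT).
exact: test_integrable hT.
Qed.

Lemma expec_prod2 P Q T c : test_fun T c ->
  expec (P \x Q)%E T = expec Q (fun y => expec P (fun x => T (x, y))).
Proof.
move=> hT; rewrite /expec /Rintegral -integral21_prod_meas1.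
  congr fine; apply: eq_integral => x _; rewrite fineK//.
  by apply: integrable_fin_num => //; exact: test_integrable (test_section2 x hT).
exact: test_integrable hT.
Qed.

(** The nonnegative quantity is the second moment of the part of [T] orthogonal
    to functions of a single coordinate (the Efron-Stein or Hoeffding
    decomposition). *)
Lemma var_marginals P Q T c : test_fun T c ->
  var P (fun x => expec Q (fun y => T (x, y))) +
  var Q (fun y => expec P (fun x => T (x, y))) <= var (P \x Q)%E T.
Proof.
move=> hT; set T1 := (fun x => _); set T2 := (fun y => _).
have h1 : test_fun T1 c by exact: (test_marginal1 P).
have h2 : test_fun T2 c by exact: (test_marginal2 P Q).
set m := expec (P \x Q)%E T.
have m1 : expec P T1 = m by rewrite -(expec_prod1 _ _ hT).
have m2 : expec Q T2 = m by rewrite -(expec_prod2 _ _ hT).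
pose U1 (z : X * Y) := T1 z.1; pose U2 (z : X * Y) := T2 z.2.
have k1 : test_fun U1 c.
  split; last by move=> z; exact: h1.2.
  by apply: (measurableT_comp (f := T1) (g := fst)) => //; exact: h1.1.
have k2 : test_fun U2 c.
  split; last by move=> z; exact: h2.2.
  by apply: (measurableT_comp (f := T2) (g := snd)) => //; exact: h2.1.
have : 0 <= expec (P \x Q)%E (fun z => (T z - U1 z - U2 z + m) ^+ 2).
  by apply: Rintegral_ge0 => x _; exact: sqr_ge0.
have -> : (fun z => (T z - U1 z - U2 z + m) ^+ 2) = (fun z =>
    1 * (T z ^+ 2) + (1 * (U1 z ^+ 2) + (1 * (U2 z ^+ 2) +
    (-2 * (U1 z * T z) + (-2 * (U2 z * T z) + (2 * (U1 z * U2 z) +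
    ((2 * m) * T z + ((- 2 * m) * U1 z + ((- 2 * m) * U2 z + m ^+ 2))))))))).
  by apply/funext => z; ring.
have c0 : test_fun (fun _ : X * Y => m ^+ 2) _ := test_cst _.
have a1 := testD (testM (test_cst (- 2 * m)) k2) c0.
have a2 := testD (testM (test_cst (- 2 * m)) k1) a1.
have a3 := testD (testM (test_cst (2 * m)) hT) a2.
have a4 := testD (testM (test_cst 2) (testM k1 k2)) a3.
have a5 := testD (testM (test_cst (-2)) (testM k2 hT)) a4.
have a6 := testD (testM (test_cst (-2)) (testM k1 hT)) a5.
have a7 := testD (testM (test_cst 1) (testX2 k2)) a6.
have a8 := testD (testM (test_cst 1) (testX2 k1)) a7.
rewrite (expec_lin _ _ (testX2 hT) a8) (expec_lin _ _ (testX2 k1) a7).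
rewrite (expec_lin _ _ (testX2 k2) a6) (expec_lin _ _ (testM k1 hT) a5).
rewrite (expec_lin _ _ (testM k2 hT) a4) (expec_lin _ _ (testM k1 k2) a3).
rewrite (expec_lin _ _ hT a2) (expec_lin _ _ k1 a1) (expec_lin _ _ k2 c0).
have e1 : expec (P \x Q)%E U1 = m.
  rewrite (expec_prod1 _ _ k1) -m1; congr expec; apply/funext => x.
  exact: (expec_cst Q (T1 x)).
have e2 : expec (P \x Q)%E U2 = m.
  rewrite (expec_prod2 _ _ k2) -m2; congr expec; apply/funext => y.
  exact: (expec_cst P (T2 y)).
have e11 : expec (P \x Q)%E (fun z => U1 z ^+ 2) = expec P (fun x => T1 x ^+ 2).
  rewrite (expec_prod1 _ _ (testX2 k1)); congr expec; apply/funext => x.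
  exact: (expec_cst Q (T1 x ^+ 2)).
have e22 : expec (P \x Q)%E (fun z => U2 z ^+ 2) = expec Q (fun x => T2 x ^+ 2).
  rewrite (expec_prod2 _ _ (testX2 k2)); congr expec; apply/funext => y.
  exact: (expec_cst P (T2 y ^+ 2)).
have e01 : expec (P \x Q)%E (fun z => U1 z * T z) = expec P (fun x => T1 x ^+ 2).
  rewrite (expec_prod1 _ _ (testM k1 hT)); congr expec; apply/funext => x.
  by apply: etrans (expecZ _ (T1 x) (test_section1 x hT)) _; rewrite expr2.
have e02 : expec (P \x Q)%E (fun z => U2 z * T z) = expec Q (fun x => T2 x ^+ 2).
  rewrite (expec_prod2 _ _ (testM k2 hT)); congr expec; apply/funext => y.
  by apply: etrans (expecZ _ (T2 y) (test_section2 y hT)) _; rewrite expr2.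
have e12 : expec (P \x Q)%E (fun z => U1 z * U2 z) = m ^+ 2.
  rewrite (expec_prod1 _ _ (testM k1 k2)).
  have -> : (fun x => expec Q (fun y => U1 (x, y) * U2 (x, y))) = (fun x => m * T1 x).
    by apply/funext => x; apply: etrans (expecZ _ (T1 x) h2) _; rewrite m2 mulrC.
  by rewrite (expecZ _ _ h1) m1 expr2.
rewrite expec_cst -/m e1 e2 e11 e22 e01 e02 e12 /var -/m m1 m2.
by move=> h; rewrite -subr_ge0; move: h; congr (0 <= _); ring.
Qed.

End product.

(** * The information bound is additive over independent observations *)

Section little_o.
Context {R : realType}.
Implicit Types (f : R -> R) (t D : R).

Lemma is_derive_near f t D e : is_derive t 1 f D -> 0 < e ->
  \forall s \near t, `|f s - f t - D * (s - t)| <= e * `|s - t|.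
Proof.
move=> [df dfD] e0.
have : h^-1 *: ((f \o shift t) (h *: 1) - f t) @[h --> 0^'] --> D.
  by rewrite -dfD; exact: df.
move=> /cvgrPdist_le /(_ _ e0); rewrite /dnbhs near_withinE => H.
have {}H : \forall h \near (0 : R), `|f (h + t) - f t - D * h| <= e * `|h|.
  move: H; apply: filterS => h H; have [->|h0] := eqVneq h 0.
    by rewrite add0r subrr mulr0 subrr !normr0 mulr0.
  have := H h0; rewrite /= /GRing.scale /= mulr1 => {}H.
  have -> : f (h + t) - f t - D * h = - h * (D - h^-1 * (f (h + t) - f t)).
    by field.
  by rewrite normrM normrN mulrC ler_wpM2r.
rewrite (near_shift 0 t) subr0; move: H; apply: filterS => h /=.
by rewrite addrK.
Qed.

Lemma is_derive_littleo f t D :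
  (forall e, 0 < e -> \forall s \near t, `|f s - f t - D * (s - t)| <= e * `|s - t|) ->
  is_derive t 1 f D.
Proof.
move=> H.
have cD : h^-1 *: ((f \o shift t) (h *: 1) - f t) @[h --> 0^'] --> D.
  apply/cvgrPdist_le => e e0; rewrite /dnbhs near_withinE.
  have := H e e0; rewrite (near_shift 0 t) subr0; apply: filterS => h /= + h0.
  rewrite addrK /GRing.scale /= mulr1 => Hh.
  have -> : D - h^-1 * (f (h + t) - f t) =
      - h^-1 * (f (h + t) - f t - D * h) by field.
  by rewrite normrM normrN normfV mulrC ler_pdivrMr ?normr_gt0.
by apply: DeriveDef; [apply: cvgP cD|apply: cvg_lim cD].
Qed.

Lemma is_derive_quadratic (r : R -> R) t (K : R) :
  (\forall s \near t, `|r s| <= K * `|s - t| ^+ 2) ->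
  is_derive t 1 r 0.
Proof.
move=> H; apply: is_derive_littleo => e e0.
have rt : r t = 0.
  have := nbhs_singleton H; rewrite subrr normr0 expr0n mulr0.
  by rewrite normr_le0 => /eqP.
pose k := Num.max K 1.
have k0 : 0 < k by rewrite lt_max ltr01 orbT.
near=> s; rewrite rt mul0r !subr0.
apply: (@le_trans _ _ (K * `|s - t| ^+ 2)); first by near: s.
rewrite expr2 mulrA ler_wpM2r//.
apply: (@le_trans _ _ (k * `|s - t|)); first by rewrite ler_wpM2r// le_max lexx.
rewrite mulrC -ler_pdivlMr// distrC; near: s.
by apply: cvgr_dist_le => //; rewrite divr_gt0.
Unshelve. all: by end_near. Qed.

End little_o.

(** Cauchy-Schwarz for two terms, written without square roots. *)
Lemma sqrD_le (R : realFieldType) (a b J K v w : R) : 0 <= J -> 0 <= K ->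
  0 <= v -> 0 <= w -> a ^+ 2 <= J * v -> b ^+ 2 <= K * w ->
  (a + b) ^+ 2 <= (J + K) * (v + w).
Proof.
move=> J0 K0 v0 w0 av bw.
have Jw : 0 <= J * w by rewrite mulr_ge0.
have Kv : 0 <= K * v by rewrite mulr_ge0.
have : `|a * b *+ 2| <= J * w + K * v.
  rewrite -ler_sqr ?nnegrE ?normr_ge0 ?addr_ge0// real_normK ?num_real//.
  have h1 : (a * b) ^+ 2 <= (J * w) * (K * v).
    rewrite exprMn (_ : J * w * (K * v) = (J * v) * (K * w)); last by ring.
    by apply: ler_pM => //; exact: sqr_ge0.
  have h2 := sqr_ge0 (J * w - K * v).
  have -> : (a * b *+ 2) ^+ 2 = 4 * (a * b) ^+ 2 by ring.
  have -> : (J * w + K * v) ^+ 2 = 4 * ((J * w) * (K * v)) + (J * w - K * v) ^+ 2.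
    by ring.
  by rewrite -[leLHS]addr0 lerD// ler_wpM2l.
move=> /(le_trans (ler_norm _)) h.
rewrite sqrrD (_ : (J + K) * (v + w) = J * v + (J * w + K * v) + K * w); last by ring.
by apply: lerD => //; apply: lerD.
Qed.

Section score_bound_product.
Context d1 d2 (X : measurableType d1) (Y : measurableType d2) (R : realType).
Variables (P : R -> probability X R) (Q : R -> probability Y R) (t J K : R).
Hypotheses (J0 : 0 <= J) (K0 : 0 <= K).

(** Moving one factor at a time differentiates the conditional expectations [T1]
    and [T2] of the statistic, whose variances add up to at most the variance
    of [T]. Moving both factors leaves a remainder of second order. *)
Lemma score_bound_prod : score_bound P t J -> score_bound Q t K ->
  score_bound (fun s => (P s \x Q s)%E) t (J + K).
Proof.
move=> [dP [C1 C10 lP]] [dQ [C2 C20 lQ]].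
pose W s (T : X * Y -> R) x :=
  expec (Q s) (fun y => T (x, y)) - expec (Q t) (fun y => T (x, y)).
have split1 s T c : test_fun T c -> expec (P s \x Q s)%E T =
    expec (P s) (fun x => expec (Q t) (fun y => T (x, y))) + expec (P s) (W s T).
  move=> hT; rewrite (expec_prod1 _ _ hT) /W.
  rewrite (expecB _ (test_marginal1 (P s) (Q s) hT) (test_marginal1 (P s) (Q t) hT)).
  by rewrite subrKC.
have EW s T c : test_fun T c -> expec (P t) (W s T) =
    expec (Q s) (fun y => expec (P t) (fun x => T (x, y))) -
    expec (P t \x Q t)%E T.
  move=> hT; rewrite (expec_prod1 _ _ hT) -(expec_prod2 _ _ hT).
  rewrite (expec_prod1 _ _ hT).
  exact: (expecB _ (test_marginal1 (P s) (Q s) hT) (test_marginal1 (P s) (Q t) hT)).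
have tW s T c : test_fun T c ->
    (forall U k, test_fun U k ->
      `|expec (Q s) U - expec (Q t) U| <= k * (C2 * `|s - t|)) ->
    test_fun (W s T) (c * (C2 * `|s - t|)).
  move=> hT H; split; last by move=> x; apply: H; exact: test_section1.
  exact: (testD (test_marginal1 (P s) (Q s) hT)
    (testN (test_marginal1 (P s) (Q t) hT))).1.
split; last first.
  exists (C1 + C2); first exact: addr_ge0.
  near=> s => T c hT.
  have HP : forall U k, test_fun U k ->
      `|expec (P s) U - expec (P t) U| <= k * (C1 * `|s - t|) by near: s.
  have HQ : forall U k, test_fun U k ->
      `|expec (Q s) U - expec (Q t) U| <= k * (C2 * `|s - t|) by near: s.
  have hW := tW _ _ _ hT HQ.
  rewrite (split1 _ _ _ hT) (expec_prod1 _ _ hT) addrAC mulrDl mulrDr.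
  apply: (le_trans (ler_normD _ _)); apply: lerD.
    exact: HP (test_marginal1 (P t) (Q t) hT).
  exact: norm_expec hW.
move=> T c hT.
set T1 := (fun x => expec (Q t) (fun y => T (x, y))).
set T2 := (fun y => expec (P t) (fun x => T (x, y))).
have h1 : test_fun T1 c := test_marginal1 (P t) (Q t) hT.
have h2 : test_fun T2 c := test_marginal2 (P t) (Q t) hT.
have [D1 d1D D1v] := dP T1 c h1.
have [D2 d2D D2v] := dQ T2 c h2.
exists (D1 + D2); last first.
  apply: (le_trans (sqrD_le J0 K0 (var_ge0 (P t) h1) (var_ge0 (Q t) h2) D1v D2v)).
  by apply: ler_wpM2l; [exact: addr_ge0|exact: var_marginals hT].
set m := expec (P t \x Q t)%E T.
(* [W s T] is the change caused by the second factor, of order [s - t]; its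
   expectation changes by another factor [s - t] when the first one moves. *)
pose rem s := expec (P s) (W s T) - expec (P t) (W s T).
have -> : (fun s => expec (P s \x Q s)%E T) =
    ((fun s => expec (P s) T1) + (fun s => expec (Q s) T2)) + rem + cst (- m).
  apply/funext => s; rewrite !fctE /= (split1 _ _ _ hT) -/T1 /rem (EW _ _ _ hT).
  rewrite -/T2 -/m; ring.
have drem : is_derive t 1 rem 0.
  apply: (@is_derive_quadratic _ _ _ (c * C2 * C1)).
  near=> s.
  have HP : forall U k, test_fun U k ->
      `|expec (P s) U - expec (P t) U| <= k * (C1 * `|s - t|) by near: s.
  have HQ : forall U k, test_fun U k ->
      `|expec (Q s) U - expec (Q t) U| <= k * (C2 * `|s - t|) by near: s.
  have := HP _ _ (tW _ _ _ hT HQ); congr (_ <= _); ring.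
rewrite -[D1 + D2]addr0 -[_ + 0]addr0.
exact: is_deriveD.
Unshelve. all: by end_near. Qed.

End score_bound_product.

Lemma expec_distribution d (X : measurableType d) (R : realType)
    d' (Y : measurableType d') (P : probability X R)
    (f : {RV P >-> Y}) (T : Y -> R) c : test_fun T c ->
  expec (distribution P f) T = expec P (T \o f) /\ test_fun (T \o f) c.
Proof.
move=> hT; have hTf : test_fun (T \o f) c.
  split; last by move=> x; exact: hT.2.
  by apply: measurableT_comp => //; exact: hT.1.
split=> //; rewrite /expec /Rintegral integral_distribution//.
- by apply/measurable_EFinP; exact: hT.1.
- exact: test_integrable hTf.
Qed.

Section score_bound_iid.
Context d (X : measurableType d) (R : realType).

Lemma expec_iid_cons (P : probability X R) n (T : n.+1.-tuple X -> R) c :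
  test_fun T c ->
  expec (iid_law P n.+1) T = expec (P \x iid_law P n)%E (T \o @cons_pair _ X n) /\
  test_fun (T \o @cons_pair _ X n) c.
Proof.
move=> hT; rewrite [iid_law P n.+1]/=.
exact: (@expec_distribution _ _ _ _ _ (P \x iid_law P n)%E (@cons_pair _ X n) T c hT).
Qed.

Lemma score_bound_iid (P : R -> probability X R) t J n : 0 <= J ->
  score_bound P t J -> score_bound (fun s => iid_law (P s) n) t (n%:R * J).
Proof.
move=> J0 sP; elim: n => [|n IH].
  split.
    move=> T c hT; exists 0.
      exact: (is_derive_cst (expec (iid_law (P t) 0) T)).
    by rewrite mul0r mul0r expr0n.
  exists 0 => //; near=> s => T c _.
  by rewrite subrr normr0 mul0r mulr0.
have [H1 [C C0 H2]] := score_bound_prod J0 (mulr_ge0 (ler0n _ n) J0) sP IH.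
pose E s T := expec (P s \x iid_law (P s) n)%E (T \o @cons_pair _ X n).
have EE s T c : test_fun T c ->
    expec (iid_law (P s) n.+1) T = E s T /\ test_fun (T \o @cons_pair _ X n) c.
  by exact: expec_iid_cons.
split.
  move=> T c hT; have [_ hT'] := EE t T c hT.
  have [D dD Dv] := H1 _ _ hT'; exists D.
    suff -> : (fun s => expec (iid_law (P s) n.+1) T) = (fun s => E s T) by [].
    by apply/funext => s; have [] := EE s T c hT.
  rewrite -natr1 mulrDl mul1r addrC; move: Dv; congr (_ <= _ * _).
  rewrite /var; have [-> _] := EE t T c hT.
  by have [-> _] := EE t _ _ (testX2 hT).
exists C => //; near=> s => T c hT.
have [-> hT'] := EE s T c hT; have [-> _] := EE t T c hT.
suff : forall (T : X * n.-tuple X -> R) c, test_fun T c ->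
  `|expec (P s \x iid_law (P s) n)%E T - expec (P t \x iid_law (P t) n)%E T|
    <= c * (C * `|s - t|) by apply.
by near: s.
Unshelve. all: by end_near. Qed.

End score_bound_iid.

(** * Densities and square integrable functions *)

Section density.
Context d (X : measurableType d) (R : realType).
Variable nu : {sigma_finite_measure set X -> \bar R}.
Implicit Types (P : probability X R) (p : X -> R).

(** The Radon-Nikodym derivative agrees almost everywhere with the given density,
    since they have the same integrals over measurable sets. *)
Lemma ge0_integral_density P p (f : X -> \bar R) : has_density nu P p ->
  measurable_fun setT f -> (forall x, 0 <= f x)%E ->
  (\int[P]_x f x = \int[nu]_x (f x * (p x)%:E))%E.
Proof.
move=> [mp p0 PE] mf f0.
have Pnu : P `<< nu.
  apply/null_content_dominatesP => A mA nuA; rewrite PE//.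
  by apply: null_set_integral => //; exact/measurable_EFinP/measurable_funTS.
rewrite -(Radon_Nikodym_SigmaFinite.change_of_variables Pnu f0)//.
have mg := Radon_Nikodym_SigmaFinite.f_integrable Pnu.
apply: ge0_ae_eq_integral => //.
- by apply: emeasurable_funM => //; exact: measurable_int mg.
- by apply: emeasurable_funM => //; exact/measurable_EFinP.
- by move=> x _; rewrite mule_ge0//; exact: Radon_Nikodym_SigmaFinite.f_ge0.
- by move=> x _; rewrite mule_ge0// lee_fin.
apply: ae_eqe_mul2l; apply: integral_ae_eq => //.
- exact/measurable_EFinP.
- move=> E _ mE; rewrite -PE//.
  by rewrite -Radon_Nikodym_SigmaFinite.f_integral.
Qed.

Lemma density_integrable P p : has_density nu P p ->
  nu.-integrable setT (EFin \o p) /\ \int[nu]_x p x = 1.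
Proof.
move=> [mp p0 PE].
have E1 : (\int[nu]_x (p x)%:E = 1)%E by rewrite -PE ?probability_setT.
split; last by rewrite /Rintegral E1.
apply/integrableP; split; first exact/measurable_EFinP.
under eq_integral do rewrite gee0_abs ?lee_fin//.
by rewrite E1 ltry.
Qed.

(** A bounded statistic becomes nonnegative after adding its bound, which reduces
    to nonnegative integrands. *)
Lemma expec_density P p (T : X -> R) c : has_density nu P p -> test_fun T c ->
  nu.-integrable setT (EFin \o (fun x => T x * p x)) /\
  expec P T = \int[nu]_x (T x * p x).
Proof.
move=> hP hT; have [ip p1] := density_integrable hP.
have [mp p0 PE] := hP.
have iTp : nu.-integrable setT (EFin \o (fun x => T x * p x)).
  apply: (@le_integrable _ _ _ nu setT measurableT _ (EFin \o (fun x => c * p x))) => //.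
  - by apply/measurable_EFinP; apply: measurable_funM => //; exact: hT.1.
  - move=> x _ /=; rewrite lee_fin !normrM ler_wpM2r//.
    by rewrite (le_trans (hT.2 x))// ler_norm.
  - rewrite (_ : EFin \o _ = (fun x => c%:E * (EFin \o p) x)%E)//.
    exact: integrableZl.
split=> //.
have c0 x : 0 <= T x + c.
  by have := hT.2 x; rewrite ler_norml => /andP[h _]; rewrite -lerBlDr sub0r.
have hTc : test_fun (fun x => T x + c) (c + `|c|) := testD hT (test_cst c).
have E : expec P (fun x => T x + c) = \int[nu]_x ((T x + c) * p x).
  rewrite /expec /Rintegral (ge0_integral_density hP)//.
  by apply/measurable_EFinP; exact: hTc.1.
rewrite (expecD _ hT (test_cst c)) expec_cst in E.
have E2 : \int[nu]_x ((T x + c) * p x) = \int[nu]_x (T x * p x) + c.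
  under eq_Rintegral do rewrite mulrDl.
  rewrite RintegralD//; last first.
    rewrite (_ : EFin \o _ = (fun x => c%:E * (EFin \o p) x)%E)//.
    exact: integrableZl.
  by rewrite RintegralZl// p1 mulr1.
by apply: (addIr c); rewrite -E2 -E.
Qed.

End density.

Lemma normM_le_sqrD (R : realFieldType) (x y : R) : `|x * y| <= x ^+ 2 + y ^+ 2.
Proof.
rewrite normrM -(real_normK (num_real x)) -(real_normK (num_real y)).
move: `|x| `|y| => u v; rewrite -subr_ge0.
have -> : u ^+ 2 + v ^+ 2 - u * v = 2^-1 * ((u - v) ^+ 2 + u ^+ 2 + v ^+ 2) by field.
by rewrite mulr_ge0// !addr_ge0// sqr_ge0.
Qed.

Lemma sqrM_le (R : realFieldType) (x y c : R) : `|x| <= c ->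
  `|(x * y) ^+ 2| <= `|c ^+ 2 * y ^+ 2|.
Proof.
move=> xc; have c0 : 0 <= c := le_trans (normr_ge0 x) xc.
rewrite (ger0_norm (sqr_ge0 (x * y))) (ger0_norm (mulr_ge0 (sqr_ge0 c) (sqr_ge0 y))).
rewrite exprMn ler_wpM2r ?sqr_ge0//.
by rewrite -(real_normK (num_real x)) ler_sqr ?nnegrE.
Qed.

Section square_integrable.
Context d (X : measurableType d) (R : realType).
Variable nu : {measure set X -> \bar R}.
Implicit Types f g : X -> R.

Lemma integrable_scale f (r : R) : nu.-integrable setT (EFin \o f) ->
  nu.-integrable setT (EFin \o (fun x => r * f x)).
Proof.
move=> h; rewrite (_ : EFin \o _ = (fun x => r%:E * (EFin \o f) x)%E)//.
exact: integrableZl.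
Qed.

Lemma integrable_add f g : nu.-integrable setT (EFin \o f) ->
  nu.-integrable setT (EFin \o g) ->
  nu.-integrable setT (EFin \o (fun x => f x + g x)).
Proof.
move=> hf hg; rewrite (_ : EFin \o _ = (EFin \o f) \+ (EFin \o g))%E//.
exact: integrableD.
Qed.

Lemma integrable_sub f g : nu.-integrable setT (EFin \o f) ->
  nu.-integrable setT (EFin \o g) ->
  nu.-integrable setT (EFin \o (fun x => f x - g x)).
Proof.
move=> hf hg; rewrite (_ : EFin \o _ = (EFin \o f) \- (EFin \o g))%E//.
exact: integrableB.
Qed.

Definition sqint f := measurable_fun setT f /\
  nu.-integrable setT (EFin \o (fun x => f x ^+ 2)).

Lemma sqintM f g : sqint f -> sqint g ->
  nu.-integrable setT (EFin \o (fun x => f x * g x)).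
Proof.
move=> [mf sf] [mg sg].
apply: (@le_integrable _ _ _ nu setT measurableT _
  ((EFin \o (fun x => f x ^+ 2)%R) \+ (EFin \o (fun x => g x ^+ 2)%R))%E) => //.
- by apply/measurable_EFinP; exact: measurable_funM.
- move=> x _; rewrite /= lee_fin [leRHS]ger0_norm; last by rewrite addr_ge0 ?sqr_ge0.
  exact: normM_le_sqrD.
- exact: integrableD.
Qed.

Lemma sqint_scale f (r : R) : sqint f -> sqint (fun x => r * f x).
Proof.
move=> [mf sf]; split; first exact: measurable_funM.
rewrite (_ : EFin \o _ = (fun x => (r ^+ 2)%:E * (EFin \o (fun x => f x ^+ 2)%R) x)%E).
  exact: integrableZl.
by apply/funext => x; rewrite /= exprMn.
Qed.

Lemma sqintD f g : sqint f -> sqint g -> sqint (fun x => f x + g x).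
Proof.
move=> hf hg; split; first by apply: measurable_funD; [exact: hf.1|exact: hg.1].
rewrite (_ : EFin \o _ = (((EFin \o (fun x => f x ^+ 2)%R) \+
   (EFin \o (fun x => (2 * f x) * g x)%R)) \+ (EFin \o (fun x => g x ^+ 2)%R))%E).
  apply: integrableD => //; last exact: hg.2.
  apply: integrableD => //; first exact: hf.2.
  exact: (sqintM (sqint_scale 2 hf) hg).
by apply/funext => x /=; rewrite -!EFinD; congr EFin; ring.
Qed.

Lemma sqintMtest f (T : X -> R) c : test_fun T c -> sqint f ->
  sqint (fun x => T x * f x).
Proof.
move=> [mT bT] [mf sf]; split; first exact: measurable_funM.
apply: (@le_integrable _ _ _ nu setT measurableT _
  (fun x => (c ^+ 2)%:E * (EFin \o (fun x => f x ^+ 2)%R) x)%E) => //.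
- by apply/measurable_EFinP; apply: measurable_funX; exact: measurable_funM.
- by move=> x _; rewrite /= lee_fin; exact: sqrM_le.
- exact: integrableZl.
Qed.

Lemma cauchy_schwarz f g : sqint f -> sqint g ->
  (\int[nu]_x (f x * g x)) ^+ 2 <=
  (\int[nu]_x (f x ^+ 2)) * (\int[nu]_x (g x ^+ 2)).
Proof.
move=> hf hg; set A := \int[nu]_x (f x ^+ 2); set C := \int[nu]_x (g x ^+ 2).
set B := \int[nu]_x (f x * g x).
have A0 : 0 <= A by apply: Rintegral_ge0 => x _; exact: sqr_ge0.
have C0 : 0 <= C by apply: Rintegral_ge0 => x _; exact: sqr_ge0.
have H a b : 0 <= a ^+ 2 * A + 2 * a * b * B + b ^+ 2 * C.
  have : 0 <= \int[nu]_x ((a * f x + b * g x) ^+ 2).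
    by apply: Rintegral_ge0 => x _; exact: sqr_ge0.
  have -> : (fun x => (a * f x + b * g x) ^+ 2) = (fun x =>
     (a ^+ 2 * f x ^+ 2 + (2 * a * b) * (f x * g x)) + b ^+ 2 * g x ^+ 2).
    by apply/funext => x; ring.
  have i1 : nu.-integrable setT (EFin \o (fun x => a ^+ 2 * f x ^+ 2)).
    by apply: integrable_scale; exact: hf.2.
  have i2 : nu.-integrable setT (EFin \o (fun x => 2 * a * b * (f x * g x))).
    by apply: integrable_scale; exact: sqintM.
  have i3 : nu.-integrable setT (EFin \o (fun x => b ^+ 2 * g x ^+ 2)).
    by apply: integrable_scale; exact: hg.2.
  rewrite RintegralD//; last exact: integrable_add.
  rewrite RintegralD// !RintegralZl//; [exact: hg.2|exact: sqintM|exact: hf.2].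
have [C00|C00] := eqVneq C 0.
  have [->|B0] := eqVneq B 0; first by rewrite expr0n mulr_ge0.
  have := H 1 (- (A + 1) / (2 * B)); rewrite C00 mulr0 addr0 expr1n mul1r mulr1.
  have -> : A + 2 * (- (A + 1) / (2 * B)) * B = -1 by field.
  by rewrite lerNr oppr0 ler10.
have C1 : 0 < C by rewrite lt_def C00.
have := H C (- B); rewrite (_ : _ + _ = C * (A * C - B ^+ 2)); last by ring.
by rewrite pmulr_rge0// subr_ge0.
Qed.

End square_integrable.

Lemma young (R : realFieldType) (e x y : R) : 0 < e ->
  2 * `|x * y| <= e * x ^+ 2 + 1 / e * y ^+ 2.
Proof.
move=> e0; rewrite normrM -(real_normK (num_real x)) -(real_normK (num_real y)).
move: `|x| `|y| => u v; rewrite -subr_ge0.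
have -> : e * u ^+ 2 + 1 / e * v ^+ 2 - 2 * (u * v) = (e * u - v) ^+ 2 / e.
  by field; rewrite gt_eqF.
by rewrite divr_ge0 ?sqr_ge0// ltW.
Qed.

(** * Hellinger differentiable families satisfy the information bound *)

Section hellinger.
Context d (X : measurableType d) (R : realType).
Variables (nu : {sigma_finite_measure set X -> \bar R}).
Variables (P : R -> probability X R) (p : R -> X -> R) (t : R) (xi : X -> R).
Hypothesis density_p : \forall s \near t, has_density nu (P s) (p s).
Hypothesis hellinger_p : hellinger_derivative nu p t xi.

Let rt (s : R) (x : X) : R := Num.sqrt (p s x).
Let I2 := \int[nu]_x (xi x ^+ 2).

Let I2_ge0 : 0 <= I2. Proof. by apply: Rintegral_ge0 => x _; exact: sqr_ge0. Qed.

Lemma sqint_rt s : has_density nu (P s) (p s) ->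
  sqint nu (rt s) /\ \int[nu]_x (rt s x ^+ 2) = 1.
Proof.
move=> hP; have [ip p1] := density_integrable hP; have [mp p0 _] := hP.
have E : (fun x => rt s x ^+ 2) = p s.
  by apply/funext => x; rewrite /rt sqr_sqrtr.
split; last by rewrite E.
split; last by rewrite E.
apply: (measurableT_comp (f := @Num.sqrt R) (g := p s)) => //.
by apply: continuous_measurable_fun; exact: sqrt_continuous.
Qed.

Lemma sqint_xi : sqint nu xi.
Proof.
have [xL _] := hellinger_p; split; last exact: Lfun2_integrable_sqr.
by move: xL => /sub_Lfun_mfun; rewrite inE.
Qed.

(** With [r] the remainder of the square root density [rt], the identity
    [rt (t + h)^2 - rt t^2 - 2 h rt t xi = 2 rt t r + (h xi + r)^2]
    leaves terms of order [o(h)], uniformly over statistics with a given bound,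
    because [int r^2 <= eta^2 h^2]. *)
Lemma hellinger_remainder (eta : R) : 0 < eta -> eta <= 1 ->
  \forall h \near 0, forall (T : X -> R) c, test_fun T c ->
   `|expec (P (t + h)) T - expec (P t) T - 2 * h * \int[nu]_x (T x * rt t x * xi x)|
     <= c * (eta * (4 + 2 * I2) * `|h|).
Proof.
move=> eta0 eta1.
have ht := nbhs_singleton density_p.
have [srt irt] := sqint_rt ht.
have sxi := sqint_xi.
have : \forall h \near 0^', ((h ^- 2)%:E * \int[nu]_x ((Num.sqrt (p (t + h) x) -
    Num.sqrt (p t x) - h * xi x) ^+ 2)%:E <= (eta ^+ 2)%:E)%E.
  have [_ /fine_cvgP[hfin /cvgrPdist_le]] := hellinger_p.
  have eta20 : 0 < eta ^+ 2 by rewrite exprn_gt0.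
  move=> /(_ _ eta20) hle; near=> h.
  have hf : ((h ^- 2)%:E * \int[nu]_x ((Num.sqrt (p (t + h) x) -
    Num.sqrt (p t x) - h * xi x) ^+ 2)%:E)%E \is a fin_num by near: h.
  rewrite -(fineK hf) lee_fin; apply: le_trans (ler_norm _) _.
  rewrite -normrN -[X in `|X|]add0r; near: h; exact: hle.
rewrite /dnbhs near_withinE => H.
have nb : \forall h \near (0 : R), `|h| <= eta.
  by apply/nbhs_ballP; exists eta => // h /=; rewrite /ball/= sub0r normrN => /ltW.
near=> h => T c hT.
have hh : `|h| <= eta by near: h.
have hth : has_density nu (P (t + h)) (p (t + h)).
  near: h; move: density_p; rewrite (near_shift 0 t) subr0.
  by apply: filterS => h /=; rewrite addrC.
have [->|h0] := eqVneq h 0.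
  by rewrite addr0 subrr mulr0 mul0r subr0 !normr0 mulr0 mulr0.
have [srth irth] := sqint_rt hth.
pose r x := rt (t + h) x - rt t x - h * xi x.
have sr : sqint nu r.
  have h1 := sqintD srth (sqintD (sqint_scale (-1) srt) (sqint_scale (- h) sxi)).
  suff -> : r = (fun x => rt (t + h) x + (-1 * rt t x + - h * xi x)) by [].
  by apply/funext => x; rewrite /r; ring.
set N := \int[nu]_x (r x ^+ 2).
have N0 : 0 <= N by apply: Rintegral_ge0 => x _; exact: sqr_ge0.
have Nh : N <= eta ^+ 2 * h ^+ 2.
  have NE : (\int[nu]_x ((Num.sqrt (p (t + h) x) -
    Num.sqrt (p t x) - h * xi x) ^+ 2)%:E)%E = N%:E.
    by rewrite /N /Rintegral fineK//; apply: integrable_fin_num => //; exact: sr.2.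
  have : 0 < h ^+ 2 by rewrite lt_def sqr_ge0 sqrf_eq0 h0.
  have : h != 0 -> h ^- 2 * N <= eta ^+ 2.
    by rewrite -lee_fin EFinM -NE; near: h; exact: H.
  move=> /(_ h0) h1 h2; move: h1.
  by rewrite mulrC ler_pdivrMr.
have [iT E1] := expec_density ht hT.
have [iTh E2] := expec_density hth hT.
have sT := sqintMtest hT srt.
have iTx := sqintM sT sxi.
set B := \int[nu]_x _.
pose f x := T x * (2 * (rt t x * r x) + (h * xi x + r x) ^+ 2).
have fE : f = (fun x => T x * p (t + h) x - T x * p t x - 2 * h * (T x * rt t x * xi x)).
  have [_ p0 _] := ht; have [_ ph0 _] := hth.
  apply/funext => x; rewrite /f -(sqr_sqrtr (p0 x)) -(sqr_sqrtr (ph0 x)).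
  by rewrite -/(rt t x) -/(rt (t + h) x) /r; ring.
have if_ : nu.-integrable setT (EFin \o f).
  rewrite fE; apply: integrable_sub; first exact: integrable_sub.
  exact: integrable_scale.
have -> : expec (P (t + h)) T - expec (P t) T - 2 * h * B = \int[nu]_x f x.
  rewrite E1 E2 /B -RintegralZl// fE RintegralB//; last 2 first.
  - exact: integrable_sub.
  - exact: integrable_scale.
  by rewrite RintegralB.
apply: (le_trans (le_normr_Rintegral measurableT if_)).
have c0 : 0 <= c := test_ge0 hT point.
pose a1 := c * (eta * `|h|); pose a2 := c * (1 / (eta * `|h|) + 2).
pose a3 := c * (2 * h ^+ 2).
pose g x := a1 * rt t x ^+ 2 + a2 * r x ^+ 2 + a3 * xi x ^+ 2.
have i1 : nu.-integrable setT (EFin \o (fun x => a1 * rt t x ^+ 2)).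
  by apply: integrable_scale; exact: srt.2.
have i2 : nu.-integrable setT (EFin \o (fun x => a2 * r x ^+ 2)).
  by apply: integrable_scale; exact: sr.2.
have i3 : nu.-integrable setT (EFin \o (fun x => a3 * xi x ^+ 2)).
  by apply: integrable_scale; exact: sxi.2.
have i12 := integrable_add i1 i2.
have ig : nu.-integrable setT (EFin \o g) by exact: integrable_add.
have habs : 0 < `|h| by rewrite normr_gt0.
have eh : 0 < eta * `|h| by rewrite mulr_gt0.
apply: (@le_trans _ _ (\int[nu]_x g x)).
  apply: le_Rintegral => //.
    by rewrite (_ : EFin \o _ = abse \o (EFin \o f))//; exact: integrable_abse.
  move=> x _; rewrite /f normrM.
  apply: (@le_trans _ _ (c * (eta * `|h| * rt t x ^+ 2 + (1 / (eta * `|h|) + 2) * r x ^+ 2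
      + 2 * h ^+ 2 * xi x ^+ 2))); last first.
    by rewrite le_eqVlt; apply/orP; left; apply/eqP; rewrite /g /a1 /a2 /a3; ring.
  apply: ler_pM => //; first exact: hT.2.
  have k1 : 2 * `|rt t x * r x| <= eta * `|h| * rt t x ^+ 2 + 1 / (eta * `|h|) * r x ^+ 2 by exact: young.
  have k2 : (h * xi x + r x) ^+ 2 <= 2 * h ^+ 2 * xi x ^+ 2 + 2 * r x ^+ 2.
    have := sqr_ge0 (h * xi x - r x); rewrite -subr_ge0 => k.
    rewrite -subr_ge0; move: k; congr (0 <= _); ring.
  apply: (le_trans (ler_normD _ _)); rewrite normrM (@ger0_norm _ 2)// [X in _ + X]ger0_norm ?sqr_ge0//.
  have := lerD k1 k2; move/le_trans; apply.
  by rewrite le_eqVlt; apply/orP; left; apply/eqP; ring.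
rewrite /g RintegralD// RintegralD// !RintegralZl//; [|exact: sxi.2|exact: sr.2|exact: srt.2].
rewrite irt -/N -/I2 mulr1.
apply: (@le_trans _ _ (c * (eta * `|h| + (1 / (eta * `|h|) + 2) * (eta ^+ 2 * h ^+ 2)
    + 2 * h ^+ 2 * I2))).
  rewrite /a1 /a2 /a3 -(mulrA c (_ + _)) -(mulrA c (_ * _) I2) -!mulrDr.
  apply: ler_wpM2l => //; rewrite lerD2r lerD2l; apply: ler_wpM2l => //.
  by rewrite addr_ge0// divr_ge0// ltW.
apply: ler_wpM2l => //.
rewrite -(real_normK (num_real h)); move: (`|h|) habs hh eh => v v0 ve ev.
have -> : eta * v + (1 / (eta * v) + 2) * (eta ^+ 2 * v ^+ 2) + 2 * v ^+ 2 * I2 =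
    v * (2 * eta + 2 * (eta * eta * v) + 2 * I2 * v).
  by field; rewrite gt_eqF// gt_eqF.
rewrite [leRHS]mulrC; apply: ler_wpM2l; first exact: ltW.
have h1 : eta * eta * v <= eta.
  rewrite -[leRHS]mulr1 -mulrA; apply: ler_wpM2l; first exact: ltW.
  by rewrite -[leRHS]mulr1; apply: ler_pM => //; [exact: ltW|exact: ltW|exact: le_trans ve eta1].
have h2 : I2 * v <= I2 * eta by apply: ler_wpM2l.
move: h1 h2; lra.
Unshelve. all: by end_near. Qed.

(** The derivative of the expectation of [T] is [2 int T rt xi]. For [T = 1] it
    vanishes, so [T] may be centred, and Cauchy-Schwarz turns
    [int (T - m)^2 rt^2] into the variance. *)
Lemma hellinger_score_bound : score_bound P t (4 * I2).
Proof.
have ht := nbhs_singleton density_p.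
have [srt irt] := sqint_rt ht.
have sxi := sqint_xi.
have K0 : 0 < 4 + 2 * I2 by rewrite ltr_wpDr// mulr_ge0.
have dE T c : test_fun T c ->
    is_derive t 1 (fun s => expec (P s) T) (2 * \int[nu]_x (T x * rt t x * xi x)).
  move=> hT; have c0 : 0 <= c := test_ge0 hT point.
  apply: is_derive_littleo => e e0.
  pose eta := Num.min 1 (e / ((c + 1) * (4 + 2 * I2))).
  have c10 : 0 < c + 1 by rewrite ltr_wpDl.
  have eta0 : 0 < eta by rewrite lt_min ltr01 divr_gt0// mulr_gt0.
  have eta1 : eta <= 1 by rewrite ge_min lexx.
  rewrite (near_shift 0 t) subr0.
  have := hellinger_remainder eta0 eta1; apply: filterS => h /(_ _ _ hT) /=.
  rewrite addrK (addrC h) => H.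
  rewrite (_ : 2 * _ * h = 2 * h * \int[nu]_x (T x * rt t x * xi x)); last by ring.
  apply: (le_trans H); rewrite mulrA; apply: ler_wpM2r => //.
  have : eta <= e / ((c + 1) * (4 + 2 * I2)) by rewrite ge_min lexx orbT.
  rewrite ler_pdivlMr; last exact: mulr_gt0.
  apply: le_trans; rewrite mulrCA; apply: ler_wpM2l; first exact: ltW.
  by apply: ler_wpM2r; [exact: ltW|rewrite lerDl].
split.
  move=> T c hT; exists (2 * \int[nu]_x (T x * rt t x * xi x)); first exact: dE hT.
  set m := expec (P t) T.
  have hTm := testD hT (test_cst (- m)).
  have D1 : \int[nu]_x (1 * rt t x * xi x) = 0.
    have [_ d1] := dE (cst 1) _ (test_cst 1).
    move: d1; rewrite (_ : (fun s => _) = cst 1); last first.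
      by apply/funext => s; rewrite expec_cst.
    rewrite derive_cst => /esym/eqP; rewrite mulf_eq0 pnatr_eq0/= => /eqP.
    by [].
  have sTm := sqintMtest hTm srt.
  have E : \int[nu]_x (T x * rt t x * xi x) = \int[nu]_x ((T x - m) * rt t x * xi x).
    have -> : (fun x => (T x - m) * rt t x * xi x) =
      (fun x => T x * rt t x * xi x - m * (1 * rt t x * xi x)).
      by apply/funext => x; ring.
    have i1 := sqintM (sqintMtest hT srt) sxi.
    have i2 := sqintM (sqintMtest (test_cst 1) srt) sxi.
    rewrite RintegralB//; last exact: integrable_scale.
    by rewrite RintegralZl// D1 mulr0 subr0.
  have V : \int[nu]_x (((T x - m) * rt t x) ^+ 2) = var (P t) T.
    have hTm2 : test_fun (fun x => (T x - m) ^+ 2) _ := testX2 hTm.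
    rewrite -(var_center (P t) hT) (expec_density ht hTm2).2 -/m.
    have [_ p0 _] := ht; apply: eq_Rintegral => x _.
    by rewrite exprMn /rt sqr_sqrtr.
  rewrite exprMn E -V (_ : 2 ^+ 2 = 4); last by ring.
  rewrite -mulrA ler_wpM2l// mulrC; exact: cauchy_schwarz.
exists (2 * (1 + I2) + (4 + 2 * I2)).
  by rewrite addr_ge0//; [rewrite mulr_ge0// addr_ge0|exact: ltW].
rewrite (near_shift 0 t) subr0.
have := hellinger_remainder ltr01 (lexx 1); apply: filterS => h H T c hT.
have := H T c hT; rewrite /= addrK (addrC h) mul1r => {}H.
have c0 : 0 <= c := test_ge0 hT point.
set B := \int[nu]_x _ in H.
have BE : `|B| <= c * (1 + I2).
  have iTx := sqintM (sqintMtest hT srt) sxi.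
  have i1 : nu.-integrable setT (EFin \o (fun x => rt t x ^+ 2)) := srt.2.
  have i2 : nu.-integrable setT (EFin \o (fun x => xi x ^+ 2)) := sxi.2.
  rewrite /I2 -irt -RintegralD// -RintegralZl//; last exact: integrable_add.
  apply: (le_trans (le_normr_Rintegral measurableT iTx)).
  apply: le_Rintegral => //.
  - by rewrite (_ : EFin \o _ = abse \o (EFin \o (fun x => T x * rt t x * xi x)))//;
      exact: integrable_abse.
  - by apply: integrable_scale; exact: integrable_add.
  - move=> x _; rewrite -mulrA normrM; apply: ler_pM => //; first exact: hT.2.
    exact: normM_le_sqrD.
rewrite -[expec _ _ - _](subrK (2 * h * B)).
apply: (le_trans (ler_normD _ _)); apply: (le_trans (lerD H (lexx _))).
rewrite !normrM (@ger0_norm _ 2)//.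
have := ler_wpM2l (mulr_ge0 (ler0n _ 2) (normr_ge0 h)) BE.
move=> k; apply: (le_trans (lerD (lexx _) k)).
by rewrite le_eqVlt; apply/orP; left; apply/eqP; ring.
Qed.

End hellinger.

(** * Increments of functions with a lower semicontinuous majorant *)

Section majorization.
Context {R : realType}.
Implicit Types (K G h : R -> R) (c d x y : R).
Local Notation mu := (@lebesgue_measure R).

(** The supremum of the points up to which the bound holds also satisfies it, and
    the local hypothesis would carry the bound past it. *)
Lemma local_majorization K G c d : c <= d ->
  {in `[c, d] &, {homo G : x y / x <= y}} ->
  (forall x, c <= x <= d -> \forall y \near x, c <= y <= d ->
     `|K y - K x| <= `|G y - G x|) ->
  `|K d - K c| <= G d - G c.
Proof.
move=> cd ndG loc.
pose S := [set x | c <= x <= d /\ `|K x - K c| <= G x - G c].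
have Sc : S c by split; rewrite ?lexx// !subrr normr0.
have ubS : has_ubound S by exists d => x [/andP[]].
have supS : has_sup S by split; [exists c|].
pose s := sup S.
have cs : c <= s by exact: ub_le_sup.
have sd : s <= d by apply: ge_sup; [exists c|move=> x [/andP[]]].
have csd : c <= s <= d by rewrite cs.
have GE x y : c <= x -> x <= y -> y <= d -> `|G y - G x| = G y - G x.
  move=> cx xy yd; rewrite ger0_norm// subr_ge0 ndG// in_itv/= ?cx ?yd ?andbT.
  - exact: le_trans yd.
  - exact: le_trans xy.
have /nbhs_ballP[e /= e0 eH] := loc s csd.
have Ss : S s.
  have [x Sx sx] := sup_adherent e0 supS; have [/andP[cx xd] Kx] := Sx.
  have xs : x <= s by exact: ub_le_sup.
  split => //.
  have := eH x; rewrite /ball/= ltr_norml => /(_ _)/wrap[].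
    by move: sx; rewrite -/s => sx; apply/andP; split; lra.
  rewrite cx xd distrC [X in _ <= X]distrC GE// => /(_ erefl) h.
  rewrite -(subrKA (K x)) (le_trans (ler_normD _ _))//.
  by move: Kx h; lra.
have [<-|sd'] := eqVneq s d; first by case: Ss.
have {}sd' : s < d by rewrite lt_def eq_sym sd'.
pose y := Num.min d (s + e / 2).
have yd : y <= d by rewrite ge_min lexx.
have sy : s < y by rewrite lt_min sd' ltrDl divr_gt0.
have ye : y <= s + e / 2 by rewrite ge_min lexx orbT.
have cy : c <= y by rewrite (le_trans cs)// ltW.
have Sy : S y.
  split; first by rewrite cy.
  have := eH y; rewrite /ball/= ltr_norml => /(_ _)/wrap[].
    by apply/andP; split; lra.
  rewrite cy yd GE// ?(ltW sy)// => /(_ erefl) h.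
  rewrite -(subrKA (K s)) (le_trans (ler_normD _ _))//.
  by move: Ss => [_]; move: h; lra.
by have := ub_le_sup ubS Sy; rewrite leNgt sy.
Qed.

Lemma lebesgue_measure_segment c d : c <= d -> mu `[c, d] = (d - c)%:E.
Proof.
move=> cd; rewrite lebesgue_measure_itv/= lte_fin; case: ltP => // dc.
by congr EFin; apply/esym/eqP; rewrite subr_eq0 eq_le dc cd.
Qed.

(** A Vitali-Caratheodory majorant. The level sets of [h] are enlarged to open
    sets of slightly larger measure, and [H] sums the indicators of these
    weighted by the upper values of the levels; openness gives the bound on a
    whole neighbourhood. *)
Lemma lsc_majorant h c d (eps : R) : c <= d -> measurable_fun setT h ->
  (forall x, 0 <= h x) -> 0 < eps ->
  exists H : R -> \bar R, [/\ measurable_fun setT H, forall x, (0 <= H x)%E,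
    (\int[mu]_x H x <= \int[mu]_(x in `[c, d]) (h x)%:E + eps%:E)%E &
    forall x, c <= x <= d -> \forall y \near x, ((h x)%:E <= H y)%E].
Proof.
move=> cd mh h0 eps0.
pose e := eps / (d - c + 1).
have e0 : 0 < e by rewrite divr_gt0// ltr_wpDl// subr_ge0.
pose E (k : nat) : set R := `[c, d] `&` h @^-1` `[k%:R * e, k.+1%:R * e[.
have mE k : measurable (E k).
  apply: measurableI => //; rewrite -[X in measurable X]setTI.
  exact: (mh measurableT _ (measurable_itv _)).
have Efin k : (mu (E k) < +oo)%E.
  apply: (@le_lt_trans _ _ (mu `[c, d])).
    by apply: le_measure; rewrite ?inE//; [exact: mE|exact: subIsetl].
  by rewrite lebesgue_measure_itv/=; case: ifP => _; rewrite ?ltry.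
pose trunk x := Num.truncn (h x / e).
have mem_level x : `[c, d]%classic x -> E (trunk x) x.
  move=> xcd; split=> //=; rewrite in_itv/=.
  have /truncn_itv/andP[] : 0 <= h x / e by rewrite divr_ge0// ltW.
  by rewrite ler_pdivlMr// ltr_pdivrMr// => -> ->.
(* Level [k] has weight [k.+1 * e], so an excess of [eta k] in measure costs
   [e / 2 ^ k.+1], and all levels together cost [e]. *)
pose eta (k : nat) : R := 2^-1 ^+ k.+1 / k.+1%:R.
have eta0 k : 0 < eta k by rewrite divr_gt0// exprn_gt0.
have /choice[U HU] : forall k, exists U,
    [/\ open U, E k `<=` U & (mu (U `\` E k) < (eta k)%:E)%E].
  by move=> k; exact: (lebesgue_regularity_outer (mE k) (Efin k) (eta0 k)).
have mU k : measurable (U k) by apply: open_measurable; have [] := HU k.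
pose f k y : \bar R := ((k.+1%:R * e)%:E * (\1_(U k) y)%:E)%E.
have f0 k y : (0 <= f k y)%E by rewrite mule_ge0// lee_fin mulr_ge0// ltW.
have mf k : measurable_fun setT (f k).
  apply: emeasurable_funM => //; apply/measurable_EFinP.
  exact: measurable_indic.
have fle k : (\int[mu]_y f k y <= \int[mu]_(x in E k) (h x + e)%:E + (e / (2 ^ k.+1)%:R)%:E)%E.
  have [_ _ /ltW UE] := HU k.
  have ke0 : 0 <= k.+1%:R * e by rewrite mulr_ge0// ltW.
  have mi : measurable_fun setT (EFin \o (\1_(U k) : R -> R)).
    by apply/measurable_EFinP; exact: measurable_indic.
  rewrite ge0_integralZl//.
  have -> : (\int[mu]_x (\1_(U k) x)%:E = mu (U k))%E.
    rewrite integral_indic; [|exact: measurableT|exact: mU].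
    by rewrite setIT.
  rewrite (measureDI mu (mU k) (mE k)) [X in (_ * X)%E]addeC ge0_muleDr//.
  apply: leeD; last first.
    apply: (@le_trans _ _ ((k.+1%:R * e)%:E * (eta k)%:E)%E).
      by apply: lee_wpmul2l; [rewrite lee_fin|exact: UE].
    rewrite -EFinM lee_fin /eta natrX exprVn le_eqVlt; apply/orP; left; apply/eqP.
    have kn : k.+1%:R != 0 :> R by rewrite pnatr_eq0.
    by move: (2 ^+ k.+1)^-1 => z; field.
  apply: (@le_trans _ _ ((k.+1%:R * e)%:E * mu (E k))%E).
    apply: lee_wpmul2l; [by rewrite lee_fin|apply: le_measure].
    - by rewrite inE; apply: measurableI; [exact: mU|exact: mE].
    - by rewrite inE; exact: mE.
    - exact: subIsetr.
  rewrite -integral_cst; last exact: mE.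
  apply: ge0_le_integral => //.
  - exact: mE.
  - apply/measurable_EFinP; apply: measurable_funTS; exact: measurable_funD.
  - move=> x [_ /=]; rewrite in_itv/= => /andP[kx _].
    by rewrite lee_fin -natr1 mulrDl mul1r lerD2r.
exists (fun y => (\sum_(k <oo) f k y)%E); split.
- exact: ge0_emeasurable_sum.
- by move=> x; apply: nneseries_ge0 => k _ _; exact: f0.
- rewrite integral_nneseries//.
  apply: (@le_trans _ _ (\sum_(k <oo) (\int[mu]_(x in E k) (h x + e)%:E +
      (e / (2 ^ k.+1)%:R)%:E))%E).
    apply: lee_nneseries => [k _ _|k _]; last exact: fle.
    by apply: integral_ge0 => y _; exact: f0.
  apply: (le_trans (epsilon_trick xpredT _ (ltW e0))).
    move=> k; apply: integral_ge0 => x _; rewrite lee_fin addr_ge0//; exact: ltW.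
  rewrite -ge0_integral_bigcup//; last 3 first.
  + apply/measurable_EFinP; apply: measurable_funTS; exact: measurable_funD.
  + by move=> x _; rewrite lee_fin addr_ge0//; exact: ltW.
  + apply/trivIsetP => i j _ _; rewrite neq_ltn => ij.
    rewrite -subset0 => x [[_ /=]]; rewrite in_itv/= => /andP[i1 i2] [_ /=].
    rewrite in_itv/= => /andP[j1 j2].
    case/orP: ij => ij.
      have : i.+1%:R * e <= j%:R * e by rewrite ler_wpM2r ?ler_nat// ltW.
      by move=> h1; have := lt_le_trans i2 (le_trans h1 j1); rewrite ltxx.
    have : j.+1%:R * e <= i%:R * e by rewrite ler_wpM2r ?ler_nat// ltW.
    by move=> h1; have := lt_le_trans j2 (le_trans h1 i1); rewrite ltxx.
  have -> : \bigcup_k E k = `[c, d]%classic.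
    by apply/seteqP; split=> [x [k _ []]//|x xcd]; exists (trunk x) => //; exact: mem_level.
  under eq_integral do rewrite EFinD.
  rewrite ge0_integralD//; last 2 first.
  + by apply/measurable_EFinP; apply: measurable_funTS.
  + by move=> x _; rewrite lee_fin ltW.
  have -> : (\int[mu]_(x in `[c, d]) e%:E = (e * (d - c))%:E)%E.
    transitivity (e%:E * mu `[c, d]%classic)%E; first exact: integral_cst.
    by rewrite lebesgue_measure_segment.
  rewrite -addeA leeD2l// -EFinD lee_fin /e -[X in _ + X]mulr1 -mulrDr divfK//.
  by rewrite gt_eqF// ltr_wpDl// subr_ge0.
  by move=> x _; rewrite lee_fin.
- move=> x cxd.
  have [oU EU _] := HU (trunk x).
  have xU : U (trunk x) x by apply: EU; apply: mem_level; rewrite /= in_itv.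
  near=> y.
  have Uy : U (trunk x) y by near: y; exact: open_nbhs_nbhs.
  apply: (@le_trans _ _ (f (trunk x) y)).
    rewrite /f indicE mem_set// mule1 lee_fin.
    have := mem_level x; rewrite /= in_itv/= => /(_ cxd)[_ /=].
    by rewrite in_itv/= => /andP[_ /ltW].
  apply: le_trans (nneseries_lim_ge (trunk x).+1 _) => //.
  by rewrite big_nat_recr//= leeDr// sume_ge0.
Unshelve. all: by end_near. Qed.

End majorization.

(** * Increment of a product with one merely differentiable factor *)

Section product_increment.
Context {R : realType}.
Local Notation mu := (@lebesgue_measure R).
Variables (c d M : R) (q g b db W dW dm : R -> R) (N : set R).
Hypothesis cd : c <= d.
Hypothesis ig : mu.-integrable setT (EFin \o g).
Hypothesis qE : forall x y, c <= x -> x <= y -> y <= d ->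
  q y - q x = \int[mu]_(t in `]x, y]) g t.
Hypotheses (mN : measurable N) (N0 : mu N = 0%E).
Hypothesis qD : forall x, c <= x <= d -> ~ N x -> is_derive x 1 q (g x).
Hypothesis bD : forall x, c <= x <= d -> is_derive x 1 b (db x).
Hypothesis WD : forall x, c <= x <= d -> is_derive x 1 W (dW x).
Hypothesis dWE : forall x, c <= x <= d -> q x * db x + dW x = q x * dm x.
Hypothesis bM : forall x, c <= x <= d -> `|b x| <= M.
Hypotheses (mb : measurable_fun setT b) (mq : measurable_fun setT q).
Hypothesis mdm : measurable_fun setT dm.

Let K x := b x * q x + W x.
Let rate x : R := `|b x * g x| + `|q x * dm x|.

Let mg : measurable_fun setT g.
Proof. by move/integrableP : ig => [/measurable_EFinP]. Qed.

Let mrate : measurable_fun setT rate.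
Proof.
by apply: measurable_funD; apply: measurableT_comp => //; exact: measurable_funM.
Qed.

Let M0 : 0 <= M.
Proof. by apply: le_trans (bM (_ : c <= c <= d)) => //; rewrite lexx cd. Qed.

Section majorant.
Variables (e : R) (H : R -> \bar R) (O : set R).
Hypothesis e0 : 0 < e.
Let h x : R := `|b x * g x| * \1_(~` N) x + `|q x * dm x| + e.
Hypotheses (mH : measurable_fun setT H) (H0 : forall x, (0 <= H x)%E).
Hypothesis hH : forall x, c <= x <= d -> \forall y \near x, ((h x)%:E <= H y)%E.
Hypotheses (oO : open O) (NO : N `<=` O).

Let Phi x : \bar R := (H x + (M * `|g x| * \1_O x)%:E)%E.
Hypothesis Phi_fin : (\int[mu]_x Phi x < +oo)%E.

Let mO : measurable (O : set (measurableTypeR R)). Proof. exact: open_measurable. Qed.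

Let Phi0 x : (0 <= Phi x)%E.
Proof. by rewrite adde_ge0// lee_fin !mulr_ge0. Qed.

Let mPhi : measurable_fun setT Phi.
Proof.
apply: emeasurable_funD => //; apply/measurable_EFinP.
apply: measurable_funM; last exact: measurable_indic.
by apply: measurable_funM => //; exact: measurableT_comp.
Qed.

Let Phi_itv_fin x y : (\int[mu]_(t in `]x, y]) Phi t)%E \is a fin_num.
Proof.
rewrite ge0_fin_numE; last by apply: integral_ge0.
by apply: le_lt_trans Phi_fin; apply: ge0_subset_integral.
Qed.

Let G x : R := fine (\int[mu]_(t in `]c, x]) Phi t)%E.

Let GB x y : c <= x -> x <= y -> (G y - G x)%:E = (\int[mu]_(t in `]x, y]) Phi t)%E.
Proof.
move=> cx xy; rewrite /G.
have E : (\int[mu]_(t in `]c, y]) Phi t =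
    \int[mu]_(t in `]c, x]) Phi t + \int[mu]_(t in `]x, y]) Phi t)%E.
  rewrite -ge0_integral_setU//=.
  - by rewrite -itv_bndbnd_setU// bnd_simp.
  - exact: measurable_funTS.
  - apply/disj_setPS => z /= []; rewrite !in_itv/= => /andP[_ zx] /andP[xz _].
    by have := lt_le_trans xz zx; rewrite ltxx.
by rewrite E fineD// addrAC subrr add0r fineK.
Qed.

Let increment_le lo hi (r s : R) : c <= lo -> lo <= hi -> hi <= d -> 0 <= r -> 0 <= s ->
  (forall z, lo < z <= hi -> ((r + s * `|g z|)%:E <= Phi z)%E) ->
  r * (hi - lo) + s * `|q hi - q lo| <= G hi - G lo.
Proof.
move=> clo lohi hid r0 s0 rsPhi.
rewrite -lee_fin GB//.
have mI : measurable (`]lo, hi] : set (measurableTypeR R)) by exact: measurable_itv.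
have ig' : mu.-integrable `]lo, hi] (EFin \o g) by exact: integrableS ig.
have iag : mu.-integrable `]lo, hi] (EFin \o (fun t => `|g t|)).
  by rewrite (_ : EFin \o _ = abse \o (EFin \o g))//; exact: integrable_abse.
have isag : mu.-integrable `]lo, hi] (EFin \o (fun t => s * `|g t|)).
  rewrite (_ : EFin \o _ = (fun t => s%:E * (EFin \o (fun t => `|g t|%R)) t)%E)//.
  exact: integrableZl.
have muI : mu `]lo, hi] = (hi - lo)%:E.
  rewrite lebesgue_measure_itv/= lte_fin; case: ltP => // h1.
  by congr EFin; apply/esym/eqP; rewrite subr_eq0 eq_le h1 lohi.
have ir : mu.-integrable `]lo, hi] (EFin \o cst r).
  have muIoo : (mu `]lo, hi] < +oo)%E by rewrite muI ltry.
  by apply: measurable_bounded_integrable => //; exact: bounded_cst.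
apply: (@le_trans _ _ (\int[mu]_(t in `]lo, hi]) (r + s * `|g t|)%:E)%E).
  have -> : (\int[mu]_(t in `]lo, hi]) (r + s * `|g t|)%:E =
     (\int[mu]_(t in `]lo, hi]) (r + s * `|g t|))%:E)%E.
    rewrite /Rintegral fineK//; apply: integrable_fin_num => //.
    rewrite (_ : (fun _ => _) = ((EFin \o cst r) \+ (EFin \o (fun t => s * `|g t|)%R))%E)//.
    exact: integrableD.
  rewrite lee_fin RintegralD// Rintegral_cst// RintegralZl//.
  apply: lerD; last first.
    apply: ler_wpM2l => //; rewrite qE//; exact: le_normr_Rintegral.
  by rewrite [X in _ <= _ * fine X](_ : _ = (hi - lo)%:E).
apply: ge0_le_integral => //.
- by move=> x _; rewrite lee_fin addr_ge0// mulr_ge0.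
- apply/measurable_EFinP; apply: measurable_funTS; apply: measurable_funD => //.
  by apply: measurable_funM => //; exact: measurableT_comp.
- exact: measurable_funTS.
Qed.

(** Where [q] is differentiable, the derivative of [K] is controlled by [h] and
    the slack [e] absorbs the error. On the exceptional set [N] only
    [q b + W] with [q] frozen is differentiated; the rest is at most [M] times
    the increment of [q], charged to the open set [O] containing [N]. *)
Let local_bound x : c <= x <= d -> exists2 s, 0 <= s &
  \forall y \near x, [/\ `|K y - K x| <= h x * `|y - x| + s * `|q y - q x| \/ ~ (c <= y <= d) &
    ((h x + s * `|g y|)%:E <= Phi y)%E].
Proof.
move=> xcd.
have [xN|xN] := pselect (N x); last first.
  exists 0 => //.
  have DK : is_derive x 1 K (b x * g x + q x * dm x).
    have bx := bD xcd; have qx := qD xcd xN; have Wx := WD xcd.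
    have -> : b x * g x + q x * dm x = (b x *: g x + q x *: db x) + dW x.
      by rewrite /GRing.scale/= -dWE// addrA.
    exact: is_deriveD.
  near=> y; split.
    left; rewrite mul0r addr0.
    have : `|K y - K x - (b x * g x + q x * dm x) * (y - x)| <= e * `|y - x|.
      by near: y; exact: is_derive_near DK e0.
    rewrite /h indicE mem_set// mulr1 => k.
    rewrite -(subrK ((b x * g x + q x * dm x) * (y - x)) (K y - K x)).
    apply: (le_trans (ler_normD _ _)); rewrite [leRHS]mulrDl [leRHS]addrC; apply: lerD => //.
    by rewrite normrM ler_wpM2r// ler_normD.
  rewrite mul0r addr0 -[leLHS]adde0; apply: leeD; last by rewrite lee_fin !mulr_ge0.
  by near: y; exact: hH.
exists M => //.
have Dphi : is_derive x 1 (fun y => q x * b y + W y) (q x * dm x).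
  have bx := bD xcd; have Wx := WD xcd.
  rewrite -dWE//; apply: is_deriveD.
near=> y; split.
  have [ycd|] := pselect (c <= y <= d); [left|by right].
  have : `|q x * b y + W y - (q x * b x + W x) - (q x * dm x) * (y - x)| <= e * `|y - x|.
    by near: y; exact: is_derive_near Dphi e0.
  rewrite /h indicE memNset ?mulr0 ?add0r; last by move=> /(_ xN).
  move=> k.
  have -> : K y - K x = (q x * b y + W y - (q x * b x + W x) - (q x * dm x) * (y - x)) +
     (q x * dm x) * (y - x) + b y * (q y - q x) by rewrite /K; ring.
  apply: (le_trans (ler_normD _ _)); apply: lerD; last first.
    by rewrite normrM ler_wpM2r// bM.
  apply: (le_trans (ler_normD _ _)); rewrite [leRHS]mulrDl [leRHS]addrC; apply: lerD => //.
  by rewrite normrM.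
rewrite EFinD; apply: leeD; first by near: y; exact: hH.
rewrite lee_fin indicE mem_set ?mulr1//.
by near: y; apply: open_nbhs_nbhs; split => //; exact: NO.
Unshelve. all: by end_near. Qed.

Lemma increment_le_majorant : `|K d - K c| <= G d - G c.
Proof.
apply: local_majorization => //.
  move=> x y; rewrite !in_itv/= => /andP[cx xd] /andP[cy yd] xy.
  by rewrite -subr_ge0 -lee_fin GB//; apply: integral_ge0.
move=> x xcd; have /andP[cx xd] := xcd.
have [s s0 /nbhs_ballP[r /= r0 B]] := local_bound xcd.
have hx0 : 0 <= h x by rewrite !addr_ge0// ?mulr_ge0// ltW.
apply/nbhs_ballP; exists r => // y yB ycd; have /andP[cy yd] := ycd.
have [[k|//] _] := B _ yB.
apply: (le_trans k).
have Bz z : Num.min x y < z <= Num.max x y -> ((h x + s * `|g z|)%:E <= Phi z)%E.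
  move=> zxy; apply: (B z _).2; move: yB zxy.
  rewrite /ball/= !ltr_norml => /andP[h1 h2].
  by case: (leP x y) => xy /andP[h3 h4]; apply/andP; split; lra.
have [xy|/ltW yx] := leP x y.
- rewrite (min_idPl xy) (max_idPr xy) in Bz.
  rewrite (@ger0_norm _ (y - x)) ?subr_ge0//.
  apply: le_trans (ler_norm _); exact: increment_le.
- rewrite (min_idPr yx) (max_idPl yx) in Bz.
  rewrite (distrC y) (distrC (q y)) (distrC (G y)) (@ger0_norm _ (x - y)) ?subr_ge0//.
  apply: le_trans (ler_norm _); exact: increment_le.
Qed.

End majorant.

(** [W] stands for a primitive of the part of the derivative of [b q] that is not
    to be estimated, so that [q b' + W' = q dm]. The integral of the majorant
    exceeds that of the rate by [e * (d - c)] from the slack, [e] from the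
    construction of [H] and [e] from the set [V] around the exceptional points. *)
Lemma product_increment_le :
  (`|K d - K c|%:E <= \int[mu]_(x in `[c, d]) (rate x)%:E)%E.
Proof.
set T := (\int[mu]_(x in `[c, d]) _)%E.
have T0 : (0 <= T)%E.
  by apply: integral_ge0 => x _; rewrite lee_fin addr_ge0.
have [->|Tfin] := eqVneq T +oo%E; first exact: leey.
apply/lee_addgt0Pr => e' e'0.
pose e := e' / (d - c + 2).
have dc0 : 0 <= d - c by rewrite subr_ge0.
have e0 : 0 < e by rewrite divr_gt0// ltr_wpDl.
have eE : e * (d - c) + e + e = e'.
  by rewrite /e; field; rewrite gt_eqF// ltr_wpDl.
pose h x : R := `|b x * g x| * \1_(~` N) x + `|q x * dm x| + e.
have mh : measurable_fun setT h.
  apply: measurable_funD => //; apply: measurable_funD.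
    apply: measurable_funM; last by apply: measurable_indic; exact: measurableC.
    by apply: measurableT_comp => //; exact: measurable_funM.
  by apply: measurableT_comp => //; exact: measurable_funM.
have h0 x : 0 <= h x.
  by rewrite /h addr_ge0 ?(ltW e0)// addr_ge0// mulr_ge0// indicE ler0n.
have [H [mH H0 intH hH]] := lsc_majorant cd mh h0 e0.
have eM0 : 0 < e / (M + 1) by rewrite divr_gt0// ltr_wpDl.
have [del [del0 delP]] := integral_normr_continuous ig eM0.
have Nfin : (mu N < +oo)%E by rewrite N0.
have [V [oV NV Vdel]] := lebesgue_regularity_outer mN Nfin del0.
have mV : measurable (V : set (measurableTypeR R)) by exact: open_measurable.
have {}Vdel : (mu V < del%:E)%E.
  rewrite (measureDI mu mV mN) [X in (_ + X)%E](_ : _ = 0%E) ?adde0//.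
  apply/eqP; rewrite eq_le measure_ge0 andbT -N0.
  by apply: le_measure; rewrite ?inE//; exact: measurableI.
have gV := delP _ mV Vdel.
pose Phi x : \bar R := (H x + (M * `|g x| * \1_V x)%:E)%E.
have inth : (\int[mu]_(x in `[c, d]) (h x)%:E <= T + (e * (d - c))%:E)%E.
  have -> : ((e * (d - c))%:E = \int[mu]_(x in `[c, d]) (cst e%:E) x)%E.
    transitivity (e%:E * mu `[c, d]%classic)%E.
      by rewrite lebesgue_measure_segment.
    by apply/esym; exact: integral_cst.
  rewrite -ge0_integralD; first last.
  - exact: measurable_cst.
  - by move=> x _; rewrite lee_fin ltW.
  - by apply/measurable_EFinP; exact: measurable_funTS.
  - by move=> x _; rewrite lee_fin addr_ge0.
  - exact: measurable_itv.
  apply: ge0_le_integral => //.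
  - by move=> x _; rewrite lee_fin.
  - by apply/measurable_EFinP; exact: measurable_funTS.
  - by apply/measurable_EFinP; apply: measurable_funTS; exact: measurable_funD.
  - move=> x _; rewrite -EFinD lee_fin /h !lerD2r indicE ler_piMr//.
    by case: (_ \in _).
have intPhi : (\int[mu]_x Phi x <= T + e'%:E)%E.
  have mMg : measurable_fun setT (fun x => (M * `|g x|)%:E).
    by apply/measurable_EFinP; apply: measurable_funM => //; exact: measurableT_comp.
  rewrite ge0_integralD; first last.
  - apply/measurable_EFinP; apply: measurable_funM; last exact: measurable_indic.
    exact/measurable_EFinP.
  - by move=> x _; rewrite lee_fin !mulr_ge0.
  - exact: mH.
  - by move=> x _.
  - exact: measurableT.
  have -> : (\int[mu]_x (M * `|g x| * \1_V x)%:E = \int[mu]_(x in V) (M * `|g x|)%:E)%E.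
    rewrite [RHS]integral_mkcond; apply: eq_integral => x _.
    by rewrite epatch_indic EFinM.
  have Me : (\int[mu]_(x in V) (M * `|g x|)%:E <= e%:E)%E.
    have ig' : mu.-integrable V (EFin \o (fun t => `|g t|)).
      rewrite (_ : EFin \o _ = abse \o (EFin \o g))//; apply: integrable_abse.
      exact: integrableS ig.
    under eq_integral do rewrite EFinM.
    rewrite integralZl//.
    have -> : (\int[mu]_(x in V) (`|g x|)%:E = (\int[mu]_(x in V) `|g x|)%:E)%E.
      by rewrite /Rintegral fineK//; exact: integrable_fin_num.
    rewrite -EFinM lee_fin.
    apply: (@le_trans _ _ (M * (e / (M + 1)))); first by apply: ler_wpM2l => //; exact: ltW.
    rewrite mulrCA ler_piMr//; first exact: ltW.
    by rewrite ler_pdivrMr ?ltr_wpDl// mul1r lerDl.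
  rewrite -eE EFinD addeA; apply: leeD => //.
  apply: (le_trans intH); rewrite EFinD addeA; apply: leeD => //.
have Phi0 x : (0 <= Phi x)%E by rewrite adde_ge0// lee_fin !mulr_ge0.
have mPhi : measurable_fun setT Phi.
  apply: emeasurable_funD => //; apply/measurable_EFinP.
  apply: measurable_funM; last exact: measurable_indic.
  by apply: measurable_funM => //; exact: measurableT_comp.
have Phi_fin : (\int[mu]_x Phi x < +oo)%E.
  apply: (le_lt_trans intPhi).
  have Tf : T \is a fin_num by rewrite ge0_fin_numE// ltey.
  by rewrite -(fineK Tf) -EFinD ltry.
apply: le_trans intPhi.
have := increment_le_majorant e0 mH H0 hH oV NV Phi_fin.
rewrite -lee_fin => k; apply: (le_trans k).
apply: (@le_trans _ _ (\int[mu]_(t in `]c, d]) Phi t)%E).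
  have I0 x y : (0 <= \int[mu]_(t in `]x, y]) Phi t)%E.
    by apply: integral_ge0 => t _; exact: Phi0.
  rewrite -[leRHS]fineK.
    by rewrite lee_fin lerBlDr lerDl; apply: fine_ge0; exact: I0.
  rewrite ge0_fin_numE//; apply: le_lt_trans Phi_fin.
  by apply: ge0_subset_integral.
by apply: ge0_subset_integral.
Qed.

End product_increment.

Lemma measurable_inv (R : realType) : measurable_fun setT (fun x : R => x^-1).
Proof.
rewrite -(setvU [set 0 : R]).
apply/measurable_funU; [exact: measurableC|exact: measurable_set1|split].
  apply: open_continuous_measurable_fun.
    by apply: closed_openC; exact: closed_eq.
  by move=> x; rewrite inE/= => /eqP x0; exact: inv_continuous.
apply: (@eq_measurable_fun _ _ _ _ _ (cst (0 : R))); last exact: measurable_cst.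
by move=> x; rewrite inE/= => ->; rewrite invr0.
Qed.

(** A zero of a nonnegative function is a minimum. *)
Lemma is_derive_min0 (R : realType) (f : R -> R) (x D : R) :
  (forall y, 0 <= f y) -> f x = 0 -> is_derive x 1 f D -> D = 0.
Proof.
move=> f0 fx dD; apply/eqP; rewrite -normr_le0; apply/ler_addgt0Pr => e e0.
rewrite add0r; have /nbhs_ballP[r /= r0 H] := is_derive_near dD e0.
have hyp h : `|h| = r / 2 -> - (D * h) <= e * (r / 2).
  move=> hr; have := H (x + h); rewrite /ball/= opprD addNKr normrN hr.
  rewrite ltr_pdivrMr// ltr_pMr// ltr1n => /(_ erefl).
  rewrite fx subr0 (addrC x) addrK hr ler_norml => /andP[_].
  by have := f0 (h + x); lra.
have r20 : 0 < r / 2 by rewrite divr_gt0.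
have h1 := hyp (r / 2) (gtr0_norm r20).
have h2 := hyp (- (r / 2)); rewrite normrN gtr0_norm// mulrN opprK in h2.
have {}h2 := h2 erefl.
rewrite ler_norml; apply/andP; split.
- by rewrite -(ler_pM2r r20) mulNr lerNl.
- by rewrite -(ler_pM2r r20).
Qed.

(** The integral of a nonnegative function is a supremum over simple functions
    below it, so monotonicity holds without measurability. The Fisher
    information is not assumed to depend measurably on the parameter. *)
Lemma ge0_le_integral_lower d (T : measurableType d) (R : realType)
    (nu : {measure set T -> \bar R}) (f1 f2 : T -> \bar R) :
  (forall x, 0 <= f1 x)%E -> (forall x, f1 x <= f2 x)%E ->
  (\int[nu]_x f1 x <= \int[nu]_x f2 x)%E.
Proof.
move=> f10 f12; rewrite !ge0_integralTE//; last first.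
  by move=> x; exact: le_trans (f12 x).
apply: le_ereal_sup => _ [h /= hf1 <-]; exists h => //= x.
exact: le_trans (f12 x).
Qed.

Lemma abs_continuous_continuous (R : realType) (q : R -> R) :
  (forall a b, abs_continuous_on q a b) -> continuous q.
Proof.
move=> acq x; apply/cvgrPdist_lt => e e0.
have [del del0 H] := abs_continuous_chain_ac (acq (x - 1) (x + 1)) e0.
near=> y.
have y1 : `|x - y| < 1 by near: y; apply: cvgr_dist_lt.
have yd : `|x - y| < del by near: y; apply: cvgr_dist_lt.
have [xy|/ltW yx] := leP x y.
- have := H [:: (x, y)]; rewrite /chain_length /chain_variation !big_seq1 /= distrC; apply.
  + move: y1; rewrite ltr_norml => /andP[h1 h2].
    by apply/and3P; split => //; lra.
  + by apply: le_lt_trans yd; rewrite -(distrC y) ler_norm.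
- have := H [:: (y, x)]; rewrite /chain_length /chain_variation !big_seq1 /=; apply.
  + move: y1; rewrite ltr_norml => /andP[h1 h2].
    by apply/and3P; split => //; lra.
  + by apply: le_lt_trans yd; rewrite ler_norm.
Unshelve. all: by end_near. Qed.

(** * The van Trees inequality on the line *)

(** Of the statistical problem there remain the mean [m] and the variance [V] of
    an estimator along the path, related by the bound [S] on the risk. The
    functional may fail to be differentiable at [tau]. *)
Section van_trees_line.
Context {R : realType}.
Local Notation mu := (@lebesgue_measure R).
Variables (q m dm V Psi dPsi : R -> R) (tau S : R).
Hypothesis q0 : forall t, 0 <= q t.
Hypothesis acq : forall a b, abs_continuous_on q a b.
Hypothesis intq : (\int[mu]_t (q t)%:E = 1)%E.
Hypothesis mD : forall t : R, is_derive t 1 m (dm t).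
Hypotheses (mdm : measurable_fun setT dm) (mV : measurable_fun setT V).
Hypothesis V0 : forall t, 0 <= V t.
Hypothesis dm0 : forall t, V t = 0 -> dm t = 0.
Hypothesis riskS : forall t, (m t - Psi t) ^+ 2 + V t <= S.
Hypothesis PsiC : continuous Psi.
Hypothesis PsiD : forall t, t != tau ->
  is_derive t 1 Psi (dPsi t) /\ {for t, continuous dPsi}.
Hypothesis dPsi0 : forall t, 0 <= dPsi t.
Hypothesis mdPsi : measurable_fun setT dPsi.

Let b t := m t - Psi t.

Let S0 : 0 <= S.
Proof. by apply: le_trans (riskS 0); rewrite addr_ge0// sqr_ge0. Qed.

Let bS t : `|b t| <= S + 1.
Proof.
have h : `|b t| ^+ 2 <= S.
  by rewrite real_normK ?num_real//; apply: le_trans (riskS t); rewrite lerDl.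
have h1 := sqr_ge0 (`|b t| - 1).
rewrite leNgt; apply/negP => k.
have : (S + 1) ^+ 2 <= `|b t| ^+ 2 by rewrite ler_sqr ?nnegrE ?addr_ge0// ltW.
rewrite sqrrD1 => k2.
have := sqr_ge0 S; move: S0 k2 h; lra.
Qed.

Let qC : continuous q. Proof. exact: abs_continuous_continuous. Qed.

Let mC : continuous m.
Proof.
by move=> x; have [d _] := mD x; apply: differentiable_continuous; apply/derivable1_diffP.
Qed.

Let mq : measurable_fun setT q. Proof. exact: continuous_measurable_fun. Qed.
Let mb : measurable_fun setT b.
Proof. by apply: measurable_funB; exact: continuous_measurable_fun. Qed.

Section window.
Variables (a0 b0 : R) (g : R -> R) (N : set R).
Hypothesis ig : mu.-integrable setT (EFin \o g).
Hypothesis qE : forall x y, a0 <= x -> x <= y -> y <= b0 ->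
  q y - q x = \int[mu]_(t in `]x, y]) g t.
Hypotheses (mN : measurable N) (N0 : mu N = 0%E).
Hypothesis qD : forall x, a0 < x < b0 -> ~ N x -> is_derive x 1 q (g x).

Let clamp_continuous (c d : R) : c <= d -> continuous (clamp c d).
Proof.
move=> cd x; apply/cvgrPdist_lt => e e0; near=> y.
have xy : `|x - y| < e by near: y; exact: cvgr_dist_lt.
apply: le_lt_trans xy; have [xy|/ltW yx] := leP x y.
- rewrite distrC (distrC x) !ger0_norm ?subr_ge0 ?clamp_le//; exact: clampB.
- rewrite !ger0_norm ?subr_ge0 ?clamp_le//; exact: clampB.
Unshelve. all: by end_near. Qed.

(** [W] is a primitive of [q dPsi], so that the derivative of [b q + W] is
    [b q' + q m'], free of [dPsi]. *)
Lemma weighted_increment c d : a0 < c -> c <= d -> d < b0 ->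
  ~~ (c <= tau <= d) ->
  (\int[mu]_(t in `[c, d]) (q t * dPsi t)%:E <= (b c * q c - b d * q d)%:E +
    \int[mu]_(t in `[c, d]) (`|b t * g t| + `|q t * dm t|)%:E)%E.
Proof.
move=> ac cd db tcd.
(* Clamping makes the integrand continuous on the whole line. *)
pose f t := q t * dPsi (clamp c d t).
have fC : continuous f.
  move=> x; apply: cvgM; first exact: qC.
  apply: continuous_comp; first exact: (clamp_continuous cd).
  apply: (PsiD _).2; apply: contra tcd => /eqP <-; exact: clamp_itv.
have fcc x y : mu.-integrable `[x, y] (EFin \o f).
  apply: continuous_compact_integrable; first exact: segment_compact.
  exact: continuous_subspaceT.
have fi x y : mu.-integrable `]x, y] (EFin \o f).
  have sub : `]x, y]%classic `<=` `[x, y]%classic by apply: subset_itv; rewrite bnd_simp.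
  exact: (@integrableS _ _ _ mu _ _ _ (measurable_itv _) (measurable_itv _) sub (fcc x y)).
pose W y := \int[mu]_(t in `]c - 1, y]) f t.
have WD x : c <= x <= d -> is_derive x 1 W (f x).
  move=> /andP[cx xd].
  have xu : x < x + 1 by rewrite ltrDl.
  have ax : (BRight (c - 1) < BRight x)%O by rewrite bnd_simp; lra.
  have [] := @continuous_FTC1 R f (BRight (c - 1)) x (x + 1) xu (fi _ _) ax (fC x).
  by move=> dW W'; apply: DeriveDef => //; rewrite -derive1E.
have WB : (\int[mu]_(t in `[c, d]) (q t * dPsi t)%:E = (W d - W c)%:E)%E.
  have fi1 y : mu.-integrable `]c - 1, y] (EFin \o f) by exact: fi.
  rewrite /W Rintegral_itvB ?bnd_simp//; last by lra.
  rewrite Rintegral_itv_obnd_cbnd; last exact: fi.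
  rewrite /Rintegral fineK; last exact: integrable_fin_num.
  by apply: eq_integral => x; rewrite inE/= in_itv/= => xcd; rewrite /f clamp_id.
have qcd x y : c <= x -> x <= y -> y <= d -> q y - q x = \int[mu]_(t in `]x, y]) g t.
  by move=> cx xy yd; apply: qE => //; [rewrite (le_trans (ltW ac))|rewrite (le_trans yd)// ltW].
have := @product_increment_le R c d (S + 1) q g b (fun t => dm t - dPsi t) W f dm N
  cd ig qcd mN N0 _ _ WD _ _ mb mq mdm.
move=> /(_ _ _ _ _)/wrap[].
- move=> x /andP[cx xd]; apply: qD.
  by rewrite (lt_le_trans ac)//= (le_lt_trans xd).
- move=> x xcd; have hm := mD x.
  have [hP _] : is_derive x 1 Psi (dPsi x) /\ {for x, continuous dPsi}.
    by apply: PsiD; apply: contra tcd => /eqP <-.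
  exact: is_deriveB.
- by move=> x xcd; rewrite /f clamp_id//; ring.
- by move=> x _; exact: bS.
move=> k; rewrite WB.
apply: (@le_trans _ _ ((b c * q c - b d * q d)%:E +
  `|b d * q d + W d - (b c * q c + W c)|%:E)%E); last exact: leeD.
rewrite -EFinD lee_fin -lerBlDl.
apply: le_trans (ler_norm _).
by rewrite le_eqVlt; apply/orP; left; apply/eqP; ring.
Qed.

Variable lam : R.
Hypothesis lam0 : 0 < lam.

(** The integrands of the Fisher information of [q] and of the information of the
    experiment, and the resulting bound for the rate; the exceptional set is
    removed because [g] is arbitrary there. *)
Let info_density t : R := g t ^+ 2 / q t * \1_(~` N) t.
Let score_density t : R := q t * (dm t ^+ 2 / V t).
Let chi t : R := lam / 2 * S * q t + (2 * lam)^-1 * (info_density t + score_density t).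

Let mg : measurable_fun setT g.
Proof. by move/integrableP : ig => [/measurable_EFinP]. Qed.

Let info_density_ge0 t : 0 <= info_density t.
Proof. by rewrite mulr_ge0// ?divr_ge0 ?sqr_ge0// indicE ler0n. Qed.

Let score_density_ge0 t : 0 <= score_density t.
Proof. by rewrite mulr_ge0// divr_ge0 ?sqr_ge0. Qed.

Let lam20 : 0 <= (2 * lam)^-1.
Proof. by rewrite invr_ge0 mulr_ge0// ltW. Qed.

Let lamS0 : 0 <= lam / 2 * S.
Proof. by rewrite mulr_ge0// divr_ge0// ltW. Qed.

Let chi0 t : 0 <= chi t.
Proof. by rewrite addr_ge0// mulr_ge0// addr_ge0. Qed.

Let measurable_info_density : measurable_fun setT info_density.
Proof.
apply: measurable_funM; last by apply: measurable_indic; exact: measurableC.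
apply: measurable_funM; first exact: measurable_funX.
exact: (measurableT_comp (@measurable_inv R)).
Qed.

Let measurable_score_density : measurable_fun setT score_density.
Proof.
apply: measurable_funM => //; apply: measurable_funM; first exact: measurable_funX.
exact: (measurableT_comp (@measurable_inv R)).
Qed.

Let mchi : measurable_fun setT chi.
Proof.
apply: measurable_funD; apply: measurable_funM => //.
exact: measurable_funD.
Qed.

(** Young's inequality with weights [lam q] and [lam V]: the terms with [b^2] and
    [V] add up to the risk. Where [q] vanishes it has a minimum, hence a zero
    derivative, and where [V] vanishes so does [dm]. *)
Lemma rate_le_chi x : a0 < x < b0 -> ~ N x -> `|b x * g x| + `|q x * dm x| <= chi x.
Proof.
move=> xab xN; have hx := qD xab xN.
have k1 : `|b x * g x| <= lam / 2 * q x * b x ^+ 2 + (2 * lam)^-1 * info_density x.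
  rewrite /info_density indicE mem_set// mulr1.
  have [qx0|qx0] := eqVneq (q x) 0.
    have g0 : g x = 0 by exact: is_derive_min0 q0 qx0 hx.
    by rewrite qx0 g0 expr0n mulr0 normr0 !(mulr0, mul0r) addr0.
  have qx : 0 < q x by rewrite lt_def qx0 q0.
  have := @young R (lam * q x) (b x) (g x) (mulr_gt0 lam0 qx).
  rewrite mulrC -ler_pdivlMr// => /le_trans; apply.
  rewrite le_eqVlt; apply/orP; left; apply/eqP; field.
  by rewrite qx0 gt_eqF.
have k2 : `|q x * dm x| <= lam / 2 * q x * V x + (2 * lam)^-1 * score_density x.
  rewrite /score_density; have [Vx0|Vx0] := eqVneq (V x) 0.
    by rewrite dm0// Vx0 expr0n !(mulr0, mul0r) normr0 addr0.
  have Vx : 0 < V x by rewrite lt_def Vx0 V0.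
  have := @young R (lam * V x) 1 (dm x) (mulr_gt0 lam0 Vx).
  rewrite mul1r expr1n mulr1 mulrC -ler_pdivlMr// => h.
  rewrite normrM (ger0_norm (q0 x)); apply: (le_trans (ler_wpM2l (q0 x) h)).
  rewrite le_eqVlt; apply/orP; left; apply/eqP; field.
  by rewrite Vx0 gt_eqF.
apply: (le_trans (lerD k1 k2)).
have h := ler_wpM2l (mulr_ge0 (ltW lam0) (q0 x)) (riskS x).
rewrite -/(b x) in h.
have -> : chi x = 2^-1 * (lam * q x * S) + (2 * lam)^-1 * (info_density x + score_density x).
  by rewrite /chi; ring.
have -> : lam / 2 * q x * b x ^+ 2 + (2 * lam)^-1 * info_density x +
  (lam / 2 * q x * V x + (2 * lam)^-1 * score_density x) =
  2^-1 * (lam * q x * (b x ^+ 2 + V x)) + (2 * lam)^-1 * (info_density x + score_density x) by ring.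
by rewrite lerD2r ler_wpM2l.
Qed.

Lemma weighted_increment_chi c d : a0 < c -> c <= d -> d < b0 ->
  ~~ (c <= tau <= d) ->
  (\int[mu]_(t in `[c, d]) (q t * dPsi t)%:E <= (b c * q c - b d * q d)%:E +
    \int[mu]_(t in `[c, d]) (chi t)%:E)%E.
Proof.
move=> ac cd db tcd; apply: (le_trans (weighted_increment ac cd db tcd)).
apply: leeD => //; apply: ae_ge0_le_integral => //.
- apply/measurable_EFinP; apply: measurable_funTS.
  by apply: measurable_funD; apply: measurableT_comp => //; exact: measurable_funM.
- by move=> x _; rewrite lee_fin.
- by apply/measurable_EFinP; exact: measurable_funTS.
exists N; split => // x /=; apply: contra_notP => xN.
rewrite in_itv/= => /andP[cx xd]; rewrite lee_fin; apply: rate_le_chi => //.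
by rewrite (lt_le_trans ac)//= (le_lt_trans xd).
Qed.

Lemma integral_chi_le c d : a0 < c -> d < b0 ->
  (\int[mu]_(t in `[c, d]) (chi t)%:E <= (lam / 2 * S)%:E + (2 * lam)^-1%:E *
    (\int[mu]_(t in [set t | (0 < q t)%R]) ((derive1 q t) ^+ 2 / q t)%:E +
     \int[mu]_t (score_density t)%:E))%E.
Proof.
move=> ac db.
have mI : measurable (`[c, d] : set (measurableTypeR R)) by exact: measurable_itv.
have le_setT (f : R -> R) : measurable_fun setT f -> (forall t, 0 <= f t) ->
    (\int[mu]_(t in `[c, d]) (f t)%:E <= \int[mu]_t (f t)%:E)%E.
  move=> mf f0; apply: ge0_subset_integral => //.
  - exact/measurable_EFinP.
  - by move=> t _; rewrite lee_fin.
have -> : (\int[mu]_(t in `[c, d]) (chi t)%:E =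
    (lam / 2 * S)%:E * \int[mu]_(t in `[c, d]) (q t)%:E +
    (2 * lam)^-1%:E * (\int[mu]_(t in `[c, d]) (info_density t)%:E +
      \int[mu]_(t in `[c, d]) (score_density t)%:E))%E.
  have m1 : measurable_fun `[c, d] (EFin \o info_density).
    by apply/measurable_EFinP; exact: measurable_funTS.
  have m2 : measurable_fun `[c, d] (EFin \o score_density).
    by apply/measurable_EFinP; exact: measurable_funTS.
  have m3 : measurable_fun `[c, d] (EFin \o q).
    by apply/measurable_EFinP; exact: measurable_funTS.
  have pos (f : R -> R) : (forall t, 0 <= f t) -> forall t : R, `[c, d]%classic t -> (0 <= (f t)%:E)%E.
    by move=> f0 t _; rewrite lee_fin.
  rewrite -(ge0_integralD mu mI (pos _ info_density_ge0) m1 (pos _ score_density_ge0) m2).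
  rewrite -(ge0_integralZl mu mI m3 (pos _ q0) (_ : 0 <= (lam / 2 * S)%:E)%E) ?lee_fin//.
  have m4 : measurable_fun `[c, d] (fun t => (info_density t)%:E + (score_density t)%:E)%E.
    exact: emeasurable_funD.
  have p4 t : `[c, d]%classic t -> (0 <= (info_density t)%:E + (score_density t)%:E)%E.
    by move=> _; rewrite adde_ge0 ?lee_fin.
  rewrite -(ge0_integralZl mu mI m4 p4 (_ : 0 <= (2 * lam)^-1%:E)%E) ?lee_fin//.
  rewrite -ge0_integralD; first by apply: eq_integral => t _; rewrite /chi EFinD !EFinM EFinD.
  - exact: mI.
  - by move=> t _; rewrite mule_ge0 ?lee_fin.
  - exact: emeasurable_funM.
  - by move=> t _; rewrite mule_ge0 ?adde_ge0 ?lee_fin.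
  - exact: emeasurable_funM.
apply: leeD.
  rewrite -[leRHS]mule1 -intq; apply: lee_wpmul2l; first by rewrite lee_fin.
  exact: le_setT.
apply: lee_wpmul2l; first by rewrite lee_fin.
apply: leeD; last exact: le_setT.
rewrite integral_mkcond [leRHS]integral_mkcond; apply: ge0_le_integral_lower => t.
  by apply: erestrict_ge0 => x _; rewrite lee_fin.
rewrite /patch; case: ifPn => [|_]; last first.
  case: ifPn => // _; rewrite lee_fin divr_ge0 ?sqr_ge0//.
rewrite inE/= in_itv/= => /andP[ct td].
rewrite /info_density indicE; have [tN|tN] := pselect (N t).
  rewrite memNset ?mulr0; last by move=> /(_ tN).
  by case: ifPn => // _; rewrite lee_fin divr_ge0 ?sqr_ge0.
rewrite mem_set// mulr1; case: ifPn => [_|].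
  have tab : a0 < t < b0 by rewrite (lt_le_trans ac)//= (le_lt_trans td).
  have [_ dqt] := qD tab tN.
  by rewrite derive1E dqt.
rewrite notin_setE/= => /negP; rewrite -leNgt => qt.
by have -> : q t = 0 by [apply/eqP; rewrite eq_le qt q0]; rewrite invr0 mulr0.
Qed.

Let Rhs : \bar R := ((lam / 2 * S)%:E + (2 * lam)^-1%:E *
    (\int[mu]_(t in [set t | (0 < q t)%R]) ((derive1 q t) ^+ 2 / q t)%:E +
     \int[mu]_t (score_density t)%:E))%E.

Let F t := b t * q t.

(** The two integrations by parts share a single copy of the right-hand side, since
    they take place on disjoint intervals. *)
Lemma gap_bound_window a b1 eps : a0 < a -> b1 < b0 -> 0 < eps ->
  a <= tau - eps -> tau + eps <= b1 ->
  (\int[mu]_(t in `[a, (tau - eps)%R]) (q t * dPsi t)%:E +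
   \int[mu]_(t in `[(tau + eps)%R, b1]) (q t * dPsi t)%:E <=
   (F a - F (tau - eps) + (F (tau + eps) - F b1))%:E + Rhs)%E.
Proof.
move=> aa bb eps0 at_ tb.
have h1 : ~~ (a <= tau <= tau - eps) by apply/negP => /andP[_]; lra.
have h2 : ~~ (tau + eps <= tau <= b1) by apply/negP => /andP[+ _]; lra.
have k1 := weighted_increment_chi aa at_ (_ : tau - eps < b0) h1.
have k2 := weighted_increment_chi (_ : a0 < tau + eps) tb bb h2.
apply: (le_trans (leeD (k1 _) (k2 _))); [lra|lra|].
rewrite addeACA -EFinD; apply: leeD => //.
apply: le_trans (integral_chi_le aa bb).
have mI x y : measurable (`[x, y] : set (measurableTypeR R)) by exact: measurable_itv.
rewrite -ge0_integral_setU; first last.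
- apply/disj_setPS => z /= []; rewrite !in_itv/= => /andP[_ zx] /andP[xz _]; lra.
- by move=> t _; rewrite lee_fin.
- by apply/measurable_EFinP; exact: measurable_funTS.
- exact: mI.
- exact: mI.
apply: ge0_subset_integral => //; first by apply: measurableU; exact: mI.
- by apply/measurable_EFinP; exact: measurable_funTS.
- by move=> t _; rewrite lee_fin.
by move=> z /= []; rewrite !in_itv/= => /andP[z1 z2]; apply/andP; split; lra.
Qed.

End window.

Let F t := b t * q t.

Let J : \bar R := (\int[mu]_t (q t * (dm t ^+ 2 / V t))%:E)%E.
Let A : \bar R := (\int[mu]_(t in [set t | (0 < q t)%R]) ((derive1 q t) ^+ 2 / q t)%:E)%E.

Lemma gap_bound lam a b1 eps : 0 < lam -> 0 < eps ->
  a <= tau - eps -> tau + eps <= b1 ->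
  (\int[mu]_(t in `[a, (tau - eps)%R]) (q t * dPsi t)%:E +
   \int[mu]_(t in `[(tau + eps)%R, b1]) (q t * dPsi t)%:E <=
   (F a - F (tau - eps) + (F (tau + eps) - F b1))%:E +
   ((lam / 2 * S)%:E + (2 * lam)^-1%:E * (A + J)))%E.
Proof.
move=> lam0 eps0 at_ tb.
have ab : a - 1 < b1 + 1 by lra.
have [g [ig qE]] := abs_continuous_integral ab (acq (a - 1) (b1 + 1)).
have [N [mN N0 NP]] := abs_continuous_derivable ig qE.
apply: (gap_bound_window ig qE mN N0 _ lam0) => //; [|lra|lra].
move=> x xab xN; have [dx dxE] : derivable q x 1 /\ derive1 q x = g x.
  by apply: contrapT => h; apply: xN; apply: NP => /= /(_ xab).
by apply: DeriveDef => //; rewrite -derive1E.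
Qed.

(** A density of total mass 1 cannot stay above [e] on a set of measure more
    than [1 / e]. *)
Let q_small (I : nat -> set R) :
  (forall k, measurable (I k)) -> (forall k, mu (I k) = k%:R%:E) ->
  forall e, 0 < e -> exists k, exists2 x, I k x & q x < e.
Proof.
move=> mI muI e e0; pose k := (Num.truncn e^-1).+1.
exists k; apply: contrapT => h.
have qe x : I k x -> e <= q x.
  by move=> Ix; rewrite leNgt; apply/negP => qx; apply: h; exists x.
have : (e%:E * mu (I k) <= 1)%E.
  rewrite -integral_cst; last exact: mI.
  rewrite -intq.
  apply: (@le_trans _ _ (\int[mu]_(x in I k) (q x)%:E)%E).
    apply: ge0_le_integral.
    - exact: mI.
    - by move=> x _; rewrite lee_fin ltW.
    - exact: measurable_cst.
    - by apply/measurable_EFinP; exact: measurable_funTS.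
    - by move=> x Ix; rewrite lee_fin; exact: qe.
  apply: ge0_subset_integral.
  - exact: mI.
  - exact: measurableT.
  - exact/measurable_EFinP.
  - by move=> x _; rewrite lee_fin.
  - by [].
rewrite muI -EFinM lee_fin leNgt => /negP; apply.
rewrite mulrC -ltr_pdivrMr// div1r.
have /truncn_itv /andP[_ //] : 0 <= e^-1 by rewrite invr_ge0 ltW.
Qed.

Lemma density_small_right x0 e : 0 < e -> exists2 x, x0 <= x & q x < e.
Proof.
move=> e0; have [||k [x]] := @q_small (fun k => `[x0, x0 + k%:R]%classic) _ _ e e0.
- by move=> k; exact: measurable_itv.
- by move=> k; rewrite lebesgue_measure_segment ?lerDl// addrAC subrr add0r.
by rewrite /= in_itv/= => /andP[h _] qx; exists x.
Qed.

Lemma density_small_left x0 e : 0 < e -> exists2 x, x <= x0 & q x < e.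
Proof.
move=> e0; have [||k [x]] := @q_small (fun k => `[x0 - k%:R, x0]%classic) _ _ e e0.
- by move=> k; exact: measurable_itv.
- by move=> k; rewrite lebesgue_measure_segment ?gerBl// opprB addrC subrK.
by rewrite /= in_itv/= => /andP[_ h] qx; exists x.
Qed.

(** The gap around [tau] shrinks and the outer end points run to infinity along
    points where [q] is small, so that the two outer boundary terms vanish and
    the two inner ones cancel. *)
Lemma van_trees_amgm lam : 0 < lam ->
  (\int[mu]_t (q t * dPsi t)%:E <= (lam / 2 * S)%:E + (2 * lam)^-1%:E * (A + J))%E.
Proof.
move=> lam0; set Rhs := (leRHS).
have mqP : measurable_fun setT (fun t => (q t * dPsi t)%:E).
  by apply/measurable_EFinP; exact: measurable_funM.
have qP0 t : (0 <= (q t * dPsi t)%:E)%E by rewrite lee_fin mulr_ge0.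
(* These sets increase to the complement of [tau]. *)
pose B (n : nat) : set (measurableTypeR R) :=
  [set t | `|t - tau| <= n%:R /\ n.+1%:R^-1 <= `|t - tau|].
have n10 (n : nat) : 0 < n.+1%:R^-1 :> R by rewrite invr_gt0.
have BE n : B n = `[tau - n%:R, tau - n.+1%:R^-1]%classic `|`
    `[tau + n.+1%:R^-1, tau + n%:R]%classic.
  have := n10 n; rewrite /B; move: (n.+1%:R^-1 : R) (n%:R : R) => z w z0.
  apply/seteqP; split=> t; rewrite /= !in_itv/=.
    have [tt|tt] := leP tau t.
      rewrite ger0_norm ?subr_ge0// => -[h1 h2]; right.
      by apply/andP; split; lra.
    rewrite ltr0_norm ?subr_lt0// => -[h1 h2]; left.
    by apply/andP; split; lra.
  case=> /andP[h1 h2].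
    have -> : `|t - tau| = tau - t by rewrite ler0_norm ?opprB//; lra.
    by split; lra.
  have -> : `|t - tau| = t - tau by rewrite ger0_norm//; lra.
  by split; lra.
have mB n : measurable (B n).
  by rewrite BE; apply: measurableU; exact: measurable_itv.
have ndB : {homo B : n k / (n <= k)%N >-> (n <= k)%O}.
  move=> n k nk; apply/subsetPset => t [h1 h2]; split.
    by rewrite (le_trans h1)// ler_nat.
  by rewrite (le_trans _ h2)// lef_pV2 ?posrE// ler_nat.
have cB := @ge0_nondecreasing_set_cvg_integral _ (measurableTypeR R) R B _ mu ndB mB
  (fun n => measurable_funTS mqP) (fun n x _ => qP0 x).
have BT : \bigcup_n B n = setT `\` [set tau].
  apply/seteqP; split=> [t [n _ [_ h]]|t [_ /= /eqP ttau]].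
    split => //= tt; move: h; rewrite tt subrr normr0 leNgt => /negP; apply.
    exact: n10.
  have t0 : 0 < `|t - tau| by rewrite normr_gt0 subr_eq0.
  rewrite /B /bigcup /=; move: t0; move: `|t - tau| => u u0.
  exists (Num.truncn u + Num.truncn u^-1).+1 => //; split.
    have /truncn_itv /andP[_ /ltW h] := ltW u0.
    by apply: (le_trans h); rewrite ler_nat ltnS leq_addr.
  rewrite -[leRHS]invrK lef_pV2 ?posrE ?invr_gt0//.
  have /truncn_itv /andP[_ /ltW h] : 0 <= u^-1 by rewrite invr_ge0 ltW.
  by apply: (le_trans h); rewrite ler_nat ltnS leqW// leq_addl.
have -> : (\int[mu]_t (q t * dPsi t)%:E = \int[mu]_(t in \bigcup_n B n) (q t * dPsi t)%:E)%E.
  rewrite BT; apply: ge0_negligible_integral => //.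
  exact: lebesgue_measure_set1.
apply: (cvge_to_le cB); near=> n.
apply/lee_addgt0Pr => e e0.
have e40 : 0 < e / 4 by rewrite divr_gt0.
have S10 : 0 < S + 1 by rewrite ltr_wpDl.
have e4S : 0 < e / 4 / (S + 1) by rewrite divr_gt0.
have [a an qa] := density_small_left (tau - n%:R - 1) e4S.
have [b1 bn qb] := density_small_right (tau + n%:R + 1) e4S.
have FC : {for tau, continuous F}.
  by apply: cvgM; [apply: cvgB; [exact: mC|exact: PsiC]|exact: qC].
have /nbhs_ballP[r /= r0 Fr] : \forall y \near tau, `|F tau - F y| < e / 4.
  by move: FC => /cvgrPdist_lt; exact.
(* Within the gap left by [B n], and close enough to [tau] for [F]. *)
pose eps := Num.min (r / 2) n.+1%:R^-1.
have r20 : 0 < r / 2 by rewrite divr_gt0.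
have eps0 : 0 < eps by rewrite lt_min r20 n10.
have epsr : eps <= r / 2 by rewrite ge_min lexx.
have epsn : eps <= n.+1%:R^-1 by rewrite ge_min lexx orbT.
have n1 : n.+1%:R^-1 <= 1 :> R by rewrite invf_le1// ler1n.
have nn : 0 <= n%:R :> R by [].
have eps1 : eps <= 1 := le_trans epsn n1.
have at_ : a <= tau - eps by lra.
have tb : tau + eps <= b1 by lra.
have F1 : `|F tau - F (tau - eps)| < e / 4.
  by apply: Fr; rewrite /ball/= opprB addrC subrK gtr0_norm//; lra.
have F2 : `|F tau - F (tau + eps)| < e / 4.
  by apply: Fr; rewrite /ball/= opprD addNKr normrN gtr0_norm//; lra.
have Fsmall x : q x < e / 4 / (S + 1) -> `|F x| < e / 4.
  rewrite ltr_pdivlMr// => h; rewrite /F normrM (ger0_norm (q0 x)) mulrC.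
  by apply: le_lt_trans h; apply: ler_wpM2l.
have F3 := Fsmall _ qa; have F4 := Fsmall _ qb.
have mI x y : measurable (`[x, y] : set (measurableTypeR R)) by exact: measurable_itv.
have key := gap_bound lam0 eps0 at_ tb.
rewrite -/Rhs in key; rewrite addeC.
apply: (@le_trans _ _ ((F a - F (tau - eps) + (F (tau + eps) - F b1))%:E + Rhs)%E); last first.
  apply: leeD => //; rewrite lee_fin; move: F1 F2 F3 F4.
  rewrite !ltr_norml => /andP[? ?] /andP[? ?] /andP[? ?] /andP[? ?]; lra.
apply: le_trans key; rewrite -ge0_integral_setU; first last.
- apply/disj_setPS => z /= []; rewrite !in_itv/= => /andP[_ zx] /andP[xz _]; lra.
- by move=> t _; exact: qP0.
- exact: measurable_funTS.
- exact: mI.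
- exact: mI.
apply: ge0_subset_integral.
- exact: mB.
- by apply: measurableU; exact: mI.
- exact: measurable_funTS.
- by move=> t _; exact: qP0.
- rewrite BE => t /=; move: epsn; move: (n.+1%:R^-1 : R) => z epsn.
  rewrite !in_itv/= => -[/andP[h1 h2]|/andP[h1 h2]]; [left|right];
  by apply/andP; split; lra.
Unshelve. all: by end_near. Qed.

End van_trees_line.

(** * The positive part of a power *)

Section pospow.
Context {R : realType}.
Implicit Types (x y a : R).

Lemma pospow_gt0E x a : 0 < x -> pospow x a = x `^ a.
Proof. by rewrite /pospow => ->. Qed.

Lemma pospow_le0 x a : x <= 0 -> pospow x a = 0.
Proof. by rewrite /pospow leNgt => /negbTE ->. Qed.

Lemma pospow_ge0 x a : 0 <= pospow x a.
Proof. by rewrite /pospow; case: ifP => // _; exact: powR_ge0. Qed.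

Lemma le_pospow x y a : 0 <= a -> x <= y -> pospow x a <= pospow y a.
Proof.
move=> a0 xy; have [x0|x0] := leP x 0; first by rewrite pospow_le0// pospow_ge0.
have y0 := lt_le_trans x0 xy.
by rewrite !pospow_gt0E// ge0_ler_powR// nnegrE ltW.
Qed.

Lemma measurable_pospow a : measurable_fun setT (fun x : R => pospow x a).
Proof.
apply: measurable_fun_if => //.
- exact: measurable_fun_ltr.
- by apply: measurable_funTS; exact: measurable_powR.
Qed.

Let near_gt0 x : 0 < x -> \forall y \near x, 0 < y.
Proof. exact: lt_nbhsr. Qed.

Let near_lt0 x : x < 0 -> \forall y \near x, y <= 0.
Proof. by move=> x0; apply: filterS (lt_nbhsl x0) => y; exact: ltW. Qed.

Lemma is_derive_pospow a x : x != 0 ->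
  is_derive x 1 (fun y => pospow y a) (a * pospow x (a - 1)).
Proof.
rewrite neq_lt => /orP[x0|x0].
  rewrite (pospow_le0 _ (ltW x0)) mulr0.
  have h : \near x, cst (0 : R) x = pospow x a.
    by near=> y; rewrite pospow_le0//; near: y; exact: near_lt0.
  exact: (near_eq_is_derive h (is_derive_cst (0 : R) x 1)).
rewrite pospow_gt0E//.
have h : \near x, x `^ a = pospow x a.
  by near=> y; rewrite pospow_gt0E//; near: y; exact: near_gt0.
exact: (near_eq_is_derive h (is_derive1_powR a x0)).
Unshelve. all: by end_near. Qed.

Lemma pospow_continuous_at a x : x != 0 -> {for x, continuous (fun y => pospow y a)}.
Proof.
move=> x0; have [d _] := is_derive_pospow a x0.
by apply: differentiable_continuous; apply/derivable1_diffP.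
Qed.

Lemma pospow_continuous a : 0 < a -> continuous (fun y : R => pospow y a).
Proof.
move=> a0 x; have [->|] := eqVneq x 0; last exact: pospow_continuous_at.
apply/cvgrPdist_lt => e e0; rewrite (pospow_le0 a (lexx 0)).
near=> y; rewrite sub0r normrN ger0_norm ?pospow_ge0//.
have [y0|y0] := leP y 0; first by rewrite pospow_le0.
have ye : y < e `^ a^-1 by near: y; apply: lt_nbhsl; exact: powR_gt0.
rewrite pospow_gt0E//.
have := gt0_ltr_powR a0 _ _ ye; rewrite !nnegrE => /(_ (ltW y0) (powR_ge0 _ _)).
by rewrite -powRrM mulVf ?gt_eqF// powRr1// ltW.
Unshelve. all: by end_near. Qed.

Lemma pospowM x y a : 0 < x -> pospow (x * y) a = x `^ a * pospow y a.
Proof.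
move=> x0; rewrite /pospow pmulr_rgt0//; case: ifP => [y0|_]; last by rewrite mulr0.
by rewrite powRM// ltW.
Qed.

End pospow.

(** The derivative is a limit of difference quotients. *)
Lemma measurable_derive1 (R : realType) (m dm : R -> R) :
  (forall t : R, is_derive t 1 m (dm t)) -> measurable_fun setT dm.
Proof.
move=> mD.
have mC : continuous m.
  move=> x; have [d _] := mD x.
  by apply: differentiable_continuous; apply/derivable1_diffP.
pose h (k : nat) (t : R) : R := k.+1%:R * (m (t + k.+1%:R^-1) - m t).
apply: (@measurable_fun_cvg _ (measurableTypeR R) R setT h).
  move=> k; apply: measurable_funM => //; apply: measurable_funB; last first.
    exact: continuous_measurable_fun.
  apply: (measurableT_comp (f := m)); first exact: continuous_measurable_fun.
  exact: measurable_funD.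
move=> t _; apply/cvgrPdist_le => e e0.
have /nbhs_ballP[r /= r0 H] := is_derive_near (mD t) e0.
near=> k.
have kr : k.+1%:R^-1 < r by near: k; exact: near_infty_natSinv_lt (PosNum r0).
have k0 : 0 < k.+1%:R :> R by [].
have := H (t + k.+1%:R^-1); rewrite /ball/= opprD addNKr normrN gtr0_norm ?invr_gt0//.
move=> /(_ kr); rewrite (addrC t) addrK [X in _ <= _ * X]gtr0_norm ?invr_gt0// => Hk.
rewrite distrC /h (_ : _ - _ = k.+1%:R * (m (k.+1%:R^-1 + t) - m t - dm t / k.+1%:R)).
  by rewrite normrM (gtr0_norm k0) mulrC -ler_pdivlMr.
by rewrite [RHS]mulrBr [X in _ = _ - X]mulrCA divff// mulr1 (addrC t).
Unshelve. all: by end_near. Qed.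

(** The best weight is [E / S]; when [S = 0] large weights force [E = 0]. *)
Lemma sqr_le_of_amgm (R : realFieldType) (E S X : R) : 0 <= S -> 0 <= X -> 0 <= E ->
  (forall lam, 0 < lam -> E <= lam / 2 * S + (2 * lam)^-1 * X) -> E ^+ 2 <= S * X.
Proof.
move=> S0 X0 E0 H; have [->|E1] := eqVneq E 0; first by rewrite expr0n mulr_ge0.
have {}E0 : 0 < E by rewrite lt_def E1.
have [S1|S1] := eqVneq S 0.
  have Y0 : 0 < X + 1 by rewrite ltr_wpDl.
  have := H _ (divr_gt0 Y0 E0); rewrite S1 mulr0 add0r.
  rewrite (_ : (2 * ((X + 1) / E))^-1 * X = E * (X / (2 * (X + 1)))); last first.
    by field; rewrite E1 gt_eqF.
  rewrite -[leLHS]mulr1 ler_pM2l// ler_pdivlMr ?mulr_gt0// mul1r.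
  by move: X0; lra.
have {}S0 : 0 < S by rewrite lt_def S1.
have := H _ (divr_gt0 E0 S0).
rewrite (_ : E / S / 2 * S + (2 * (E / S))^-1 * X = (E ^+ 2 + S * X) / (2 * E)); last first.
  by field; rewrite E1.
rewrite ler_pdivlMr ?mulr_gt0// (_ : E * (2 * E) = E ^+ 2 *+ 2); last by ring.
by rewrite mulr2n lerD2l.
Qed.

Lemma admissible_derive_ge0 (R : realType) (phi : R -> R) t : admissible phi ->
  0 <= derive1 phi t.
Proof.
move=> [[phi_inc _ [dphi _] _] _ _].
apply: (@incr_derive1_ge0 _ phi setT t); last by rewrite interiorT.
  by move=> s _; exact: dphi.
by move=> x y _ _; exact: phi_inc.
Qed.

(** * The minimax bound *)

Section minimax.
Context (R : realType) (d : measure_display) (X : measurableType d).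
Variables (nu : {sigma_finite_measure set X -> \bar R}).
Variables (alpha delta theta0 : R) (n : nat).
Variables (P : R -> probability X R) (p xi : R -> X -> R).
Hypotheses (alpha_gt0 : 0 < alpha) (delta_gt0 : 0 < delta) (n_gt0 : (0 < n)%N).
Hypothesis density_p :
  forall t, `|t - theta0| < delta -> has_density nu (P t) (p t).
Hypothesis hellinger_p :
  forall t, `|t - theta0| < delta -> hellinger_derivative nu p t (xi t).

Let I := fisher_info nu xi.
Let I4 t : R := 4 * \int[nu]_x (xi t x ^+ 2).

Let I4_ge0 t : 0 <= I4 t.
Proof. by rewrite mulr_ge0// Rintegral_ge0// => x _; exact: sqr_ge0. Qed.

Let fisher_infoE t : `|t - theta0| < delta -> I t = (I4 t)%:E.
Proof.
move=> /hellinger_p h; have [_ ixi] := sqint_xi h.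
by rewrite /I /fisher_info /I4 EFinM /Rintegral fineK//; exact: integrable_fin_num.
Qed.

Let model_score t : `|t - theta0| < delta ->
  score_bound (fun s => iid_law (P s) n) t (n%:R * I4 t).
Proof.
move=> tD; apply: score_bound_iid => //.
apply: hellinger_score_bound (hellinger_p tD).
have /nbhs_ballP : nbhs t [set s | `|s - theta0| < delta].
  apply: open_nbhs_nbhs; split=> //.
  rewrite (_ : [set s | _] = ball theta0 delta); first exact: ball_open.
  by apply/seteqP; split=> s; rewrite /ball/= distrC.
by move=> [e e0 H]; apply/nbhs_ballP; exists e => // s /H; exact: density_p.
Qed.

Section path.
Variables (phi : R -> R) (phiA : admissible phi).
Let dphi : R -> R := derive1 phi.
Let theta (t : R) : R := theta0 + delta * phi t.

Let phiD (t : R) : is_derive t 1 phi (dphi t).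
Proof.
have [[_ _ [dp _] _] _ _] := phiA.
by apply: DeriveDef; [exact: dp|rewrite /dphi derive1E].
Qed.

Let dphiC : continuous dphi.
Proof. by have [[_ _ [_ ?] _] _ _] := phiA. Qed.

Let phi_inc : {homo phi : s t / s < t}.
Proof. by have [[? _ _ _] _ _] := phiA. Qed.

Let theta_in t : `|theta t - theta0| < delta.
Proof.
have [[_ pin _ _] _ _] := phiA.
rewrite /theta addrC addKr normrM gtr0_norm// gtr_pMr//.
by rewrite ltr_norml; exact: pin.
Qed.

Let thetaD (t : R) : is_derive t 1 theta (delta * dphi t).
Proof.
have h := phiD t; rewrite -[delta * dphi t]add0r.
apply: (is_deriveD (is_derive_cst theta0 t 1) (is_deriveZ delta h)).
Qed.

Let thetaC : continuous theta.
Proof.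
move=> t; have [dt _] := thetaD t.
by apply: differentiable_continuous; apply/derivable1_diffP.
Qed.

Let dphi_ge0 t : 0 <= dphi t.
Proof. exact: admissible_derive_ge0. Qed.

Let Psi (t : R) : R := pospow (theta t) alpha.
Let dPsi (t : R) : R := alpha * delta * (pospow (theta t) (alpha - 1) * dphi t).

Let PsiC : continuous Psi.
Proof.
move=> t; apply: (@continuous_comp _ _ _ theta (fun x => pospow x alpha)).
  exact: thetaC.
exact: pospow_continuous.
Qed.

Let PsiD (t : R) : theta t != 0 -> is_derive t 1 Psi (dPsi t) /\ {for t, continuous dPsi}.
Proof.
move=> t0; split.
  have h1 := is_derive_pospow alpha t0; have h2 := thetaD t.
  have -> : dPsi t = (alpha * pospow (theta t) (alpha - 1)) * (delta * dphi t).
    by rewrite /dPsi; ring.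
  exact: is_derive1_comp.
apply: cvgM; first exact: cvg_cst.
apply: cvgM; last exact: dphiC.
apply: (@continuous_comp _ _ _ theta (fun x => pospow x (alpha - 1))).
  exact: thetaC.
exact: pospow_continuous_at.
Qed.

(** [theta] is injective, so it vanishes at most once; if it never does, any point
    serves. *)
Let exceptional : exists tau, forall t, t != tau -> theta t != 0.
Proof.
have [[tau th]|h] := pselect (exists tau, theta tau = 0); last first.
  by exists 0 => t _; apply/eqP => t0; apply: h; exists t.
exists tau => t ttau; apply/eqP => t0.
have tE : phi t = phi tau.
  by apply: (mulfI (lt0r_neq0 delta_gt0)); apply: (addrI theta0); rewrite -/(theta t) t0 -th.
by case: (ltgtP t tau) ttau => // /phi_inc; rewrite tE ltxx.
Qed.

Let dPsi_ge0 t : 0 <= dPsi t.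
Proof.
by rewrite !mulr_ge0 ?pospow_ge0 ?dphi_ge0// ltW.
Qed.

Let mdPsi : measurable_fun setT dPsi.
Proof.
apply: measurable_funM => //; apply: measurable_funM; last first.
  exact: continuous_measurable_fun.
apply: (measurableT_comp (measurable_pospow (alpha - 1))).
exact: continuous_measurable_fun.
Qed.

Section estimator.
Variables (T : n.-tuple X -> R) (mT : measurable_fun setT T).
Let risk t := (\int[iid_law (P t) n]_x (`|T x - pospow t alpha| ^+ 2)%:E)%E.
Variable S : R.
Hypothesis riskS : forall t, `|t - theta0| < delta -> (risk t <= S%:E)%E.

Let top := pospow (theta0 + delta) alpha.
Let top0 : 0 <= top := pospow_ge0 _ _.
Let U x := clamp 0 top (T x).

Let tU : test_fun U top.
Proof.
split; last by move=> x; have /andP[h1 h2] := clamp_itv (T x) top0; rewrite ger0_norm.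
apply: measurable_maxr => //; apply: measurable_minr => //.
Qed.

Let L (t : R) := iid_law (P (theta t)) n.
Let m (t : R) : R := expec (L t) U.
Let V (t : R) : R := var (L t) U.

(** The chain rule along the path. *)
Let expecD_path (W : n.-tuple X -> R) (c t : R) : test_fun W c ->
  exists2 D : R, is_derive t 1 (fun s : R => expec (L s) W) (D * (delta * dphi t)) &
    D ^+ 2 <= n%:R * I4 (theta t) * var (L t) W.
Proof.
move=> tW; have [H _] := model_score (theta_in t).
have [D dD Dv] := H W c tW; exists D => //.
exact: (is_derive1_comp dD (thetaD t)).
Qed.

Let dm : R -> R := derive1 m.

Let mD (t : R) : is_derive t 1 m (dm t).
Proof.
have [D [dD _] _] := expecD_path t tU.
by apply: DeriveDef => //; rewrite /dm derive1E.
Qed.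

Let dm_le t : dm t ^+ 2 <= n%:R * delta ^+ 2 * (dphi t ^+ 2 * I4 (theta t)) * V t.
Proof.
have [D dD Dv] := expecD_path t tU.
have -> : dm t = D * (delta * dphi t) by rewrite /dm derive1E; have [_ ->] := dD.
rewrite exprMn.
have := ler_wpM2r (sqr_ge0 (delta * dphi t)) Dv => /le_trans; apply.
by rewrite le_eqVlt; apply/orP; left; apply/eqP; rewrite /V; ring.
Qed.

Let V_ge0 t : 0 <= V t := var_ge0 (L t) tU.

Let mV : measurable_fun setT V.
Proof.
have C (W : n.-tuple X -> R) c : test_fun W c -> measurable_fun setT (fun t => expec (L t) W).
  move=> tW; apply: continuous_measurable_fun => t.
  have [D [dD _] _] := expecD_path t tW.
  by apply: differentiable_continuous; apply/derivable1_diffP.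
apply: measurable_funB; first exact: C (testX2 tU).
by apply: measurable_funX; exact: C tU.
Qed.

(** Clamping to an interval that contains [Psi t] moves the estimate closer to
    [Psi t]. *)
Let bias_variance t : (m t - Psi t) ^+ 2 + V t <= S.
Proof.
have Psi_itv : 0 <= Psi t <= top.
  rewrite pospow_ge0 le_pospow// 1?ltW//.
  by have := theta_in t; rewrite ltr_norml ltrBlDl => /andP[].
have UT x : `|U x - Psi t| <= `|T x - Psi t|.
  rewrite -(clamp_id Psi_itv) /U.
  wlog: / Psi t <= T x.
    move=> H; have [|/ltW] := leP (Psi t) (T x); first exact: H.
    move=> h; rewrite distrC [leRHS]distrC (clamp_id Psi_itv).
    rewrite ger0_norm ?ger0_norm ?subr_ge0//.
      by have := clampB top0 h; rewrite (clamp_id Psi_itv).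
    by have := clamp_le 0 top h; rewrite (clamp_id Psi_itv).
  move=> h; rewrite (clamp_id Psi_itv) ger0_norm ?ger0_norm ?subr_ge0//.
    by have := clampB top0 h; rewrite (clamp_id Psi_itv).
  by have := clamp_le 0 top h; rewrite (clamp_id Psi_itv).
pose W x := (U x - Psi t) ^+ 2.
have tUP := testD tU (test_cst (- Psi t)).
have tW : test_fun W _ := testX2 tUP.
have -> : (m t - Psi t) ^+ 2 + V t = expec (L t) W.
  have -> : W = (fun x => U x ^+ 2 + (- (Psi t *+ 2) * U x + Psi t ^+ 2)).
    by apply/funext => x; rewrite /W; ring.
  have t2 := testM (test_cst (- (Psi t *+ 2))) tU.
  rewrite (expecD _ (testX2 tU) (testD t2 (test_cst (Psi t ^+ 2)))).
  rewrite (expec_lin _ _ tU (test_cst (Psi t ^+ 2))) expec_cst /V /var -/(m t).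
  by rewrite /=; ring.
rewrite -lee_fin; apply: (le_trans _ (riskS (theta_in t))).
rewrite /expec /Rintegral fineK; last exact: integrable_fin_num (test_integrable (L t) tW).
apply: ge0_le_integral_lower => x; rewrite lee_fin; first exact: sqr_ge0.
by rewrite /W -[X in X <= _]real_normK ?num_real// lerXn2r// nnegrE.
Qed.

Section prior.
Variable Q : probability (measurableTypeR R) R.
Let mu := @lebesgue_measure R.
Let A (q : R -> R) :=
  (\int[mu]_(t in [set t | (0 < q t)%R]) ((derive1 q t) ^+ 2 / q t)%:E)%E.
Let J := (\int[Q]_t ((dphi t ^+ 2)%:E * I (theta t)))%E.
Let B := ((n%:R * delta ^+ 2)%:E * J)%E.
Let E := (\int[Q]_t (dPsi t)%:E)%E.

Let mdm : measurable_fun setT dm := measurable_derive1 mD.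

Let J_ge0 : (0 <= J)%E.
Proof.
apply: integral_ge0 => t _; rewrite fisher_infoE//.
by rewrite -EFinM lee_fin mulr_ge0// sqr_ge0.
Qed.

Let ndelta_gt0 : 0 < n%:R * delta ^+ 2.
Proof. by rewrite mulr_gt0 ?ltr0n// exprn_gt0. Qed.

(** Dividing by [n delta^2] first keeps the constant on the measurable side. *)
Let information_le : (\int[Q]_t (dm t ^+ 2 / V t)%:E <= B)%E.
Proof.
rewrite -lee_pdivrMl// -ge0_integralZl//; first last.
- by rewrite lee_fin invr_ge0 ltW.
- by move=> t _; rewrite lee_fin divr_ge0// sqr_ge0.
- apply/measurable_EFinP; apply: measurable_funM; first exact: measurable_funX.
  exact: (measurableT_comp (@measurable_inv R)).
apply: ge0_le_integral_lower => t.
  rewrite -EFinM lee_fin mulr_ge0//; first by rewrite invr_ge0 ltW.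
  by rewrite divr_ge0// sqr_ge0.
rewrite fisher_infoE// -!EFinM lee_fin.
have [V0|V0] := eqVneq (V t) 0.
  by rewrite V0 invr0 !mulr0 mulr_ge0// sqr_ge0.
have {}V0 : 0 < V t by rewrite lt_def V0 V_ge0.
by rewrite ler_pdivrMl// ler_pdivrMr.
Qed.

Let density_bound q lam : ac_density Q q -> 0 < lam ->
  (E <= (lam / 2 * S)%:E + (2 * lam)^-1%:E * (A q + B))%E.
Proof.
move=> [q0 acq Qq] lam0.
have mq : measurable_fun setT q.
  by apply: continuous_measurable_fun => t; exact: abs_continuous_continuous.
have dq : has_density mu Q q by split.
have intq : (\int[mu]_t (q t)%:E = 1)%E by rewrite -Qq// probability_setT.
have dm0 t : V t = 0 -> dm t = 0.
  move=> V0; have := dm_le t; rewrite V0 mulr0 => dm2.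
  by apply/eqP; rewrite -sqrf_eq0 eq_le dm2 sqr_ge0.
have [tau htau] := exceptional.
have PsiD' (t : R) : t != tau -> is_derive t 1 Psi (dPsi t) /\ {for t, continuous dPsi}.
  by move=> /htau; exact: PsiD.
have := van_trees_amgm q0 acq intq mD mdm mV V_ge0 dm0 bias_variance PsiC PsiD' dPsi_ge0 mdPsi lam0.
have -> : (\int[mu]_t (q t * dPsi t)%:E = E)%E.
  rewrite /E (ge0_integral_density dq).
  - by apply: eq_integral => t _; rewrite -EFinM mulrC.
  - exact/measurable_EFinP.
  - by move=> t; rewrite lee_fin.
have -> : (\int[mu]_t (q t * (dm t ^+ 2 / V t))%:E = \int[Q]_t (dm t ^+ 2 / V t)%:E)%E.
  rewrite (ge0_integral_density dq).
  - by apply: eq_integral => t _; rewrite -EFinM mulrC.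
  - apply/measurable_EFinP; apply: measurable_funM; first exact: measurable_funX.
    exact: (measurableT_comp (@measurable_inv R)).
  - by move=> t; rewrite lee_fin divr_ge0// sqr_ge0.
move=> /le_trans; apply; apply: leeD => //; apply: lee_wpmul2l.
  by rewrite lee_fin invr_ge0 mulr_ge0// ltW.
exact: leeD.
Qed.

Let total := total_info n delta theta0 I Q phi.

Let location_ge0 : (0 <= location_info Q)%E.
Proof.
apply: le_ereal_inf_tmp => _ [q [q0 _ _] <-]; apply: integral_ge0 => t _.
by rewrite lee_fin divr_ge0// sqr_ge0.
Qed.

Let B_ge0 : (0 <= B)%E.
Proof. by rewrite mule_ge0// lee_fin ltW. Qed.

(** The right-hand side is affine in the information of [q], which is then
    replaced by the infimum. *)
Let total_bound lam : 0 < lam ->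
  (E <= (lam / 2 * S)%:E + (2 * lam)^-1%:E * total)%E.
Proof.
move=> lam0; have c0 : 0 < (2 * lam)^-1 by rewrite invr_gt0 mulr_gt0.
have [Boo|Bfin] := eqVneq B +oo%E.
  rewrite /total /total_info -/dphi -/theta -/J -/B Boo addey; last first.
    by rewrite gt_eqF// (lt_le_trans _ location_ge0).
  by rewrite gt0_muley ?lte_fin// addey// leey.
have {}Bfin : B \is a fin_num by rewrite ge0_fin_numE// ltey.
rewrite -leeBlDl// -lee_pdivrMl// -leeBlDr//.
apply: le_ereal_inf_tmp => _ [q Qq <-].
by rewrite leeBlDr// lee_pdivrMl// leeBlDl//; exact: density_bound.
Qed.

Let E_ge0 : (0 <= E)%E.
Proof. by apply: integral_ge0 => t _; rewrite lee_fin. Qed.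

Let S_ge0 : 0 <= S.
Proof.
by apply: le_trans (bias_variance 0); rewrite addr_ge0// sqr_ge0.
Qed.

Let sqr_expectation_le : total != +oo%E ->
  [/\ E \is a fin_num, total \is a fin_num & fine E ^+ 2 <= S * fine total].
Proof.
move=> tfin.
have t0 : (0 <= total)%E by exact: adde_ge0.
have {}tfin : total \is a fin_num by rewrite ge0_fin_numE// ltey.
have Efin : E \is a fin_num.
  rewrite ge0_fin_numE//; apply: le_lt_trans (total_bound ltr01) _.
  by rewrite -(fineK tfin) -EFinM -EFinD ltry.
split => //; apply: sqr_le_of_amgm => //; [exact: fine_ge0|exact: fine_ge0|].
move=> lam lam0; have := total_bound lam0.
by rewrite -{1}(fineK tfin) -(fineK Efin) -EFinM -EFinD lee_fin.
Qed.

(** The information may be infinite or zero. In the first case the quotient is 0;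
    in the second the numerator vanishes as well. *)
Lemma van_trees_bound (c : R) (f : R -> R) : 0 < c ->
  measurable_fun setT f -> (forall t, 0 <= f t) ->
  (forall t, c * f t <= dPsi t) ->
  ((c ^+ 2)%:E * `|'E_Q[f]| ^+ 2 / total <= S%:E)%E.
Proof.
move=> c0 mf f0 fPsi; have [->|tfin] := eqVneq total +oo%E.
  by rewrite invey mule0 lee_fin.
have [Efin totfin HE] := sqr_expectation_le tfin.
have Ef0 : (0 <= 'E_Q[f])%E by exact: expectation_ge0.
have cf : (c%:E * 'E_Q[f] <= E)%E.
  rewrite expectation.unlock -ge0_integralZl//.
  - apply: ge0_le_integral_lower => t; rewrite -EFinM lee_fin//.
    by rewrite mulr_ge0// ltW.
  - exact/measurable_EFinP.
  - by move=> t _; rewrite lee_fin.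
  - by rewrite lee_fin ltW.
have fE : ('E_Q[f] \is a fin_num)%E.
  rewrite ge0_fin_numE// ltey; apply/eqP => Ef; move: cf.
  by rewrite Ef gt0_muley ?lte_fin// leye_eq => /eqP EE; rewrite EE in Efin.
rewrite (gee0_abs Ef0); move: cf HE Ef0; rewrite -(fineK fE) -(fineK totfin) -(fineK Efin) /=.
have t0 : 0 <= fine total by rewrite fine_ge0// adde_ge0.
move: (fine _) (fine total) (fine E) t0 => e K F K0.
rewrite -EFinM !lee_fin => cf FK e0.
have ce : (c * e) ^+ 2 <= S * K.
  apply: le_trans FK; rewrite lerXn2r// nnegrE.
    by rewrite mulr_ge0// ltW.
  by rewrite (le_trans _ cf)// mulr_ge0// ltW.
rewrite -!EFinM -expr2 inver -exprMn.
have [K1|K1] := eqVneq K 0.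
  have -> : (c * e) ^+ 2 = 0.
    by apply/eqP; rewrite eq_le sqr_ge0 andbT (le_trans ce)// K1 mulr0.
  by rewrite mul0e lee_fin.
by rewrite -EFinM lee_fin ler_pdivrMr// lt_def K1.
Qed.

End prior.
End estimator.
End path.

Lemma minimax_bound (Q : probability (measurableTypeR R) R) phi (c : R)
    (f : R -> R) : admissible phi -> 0 < c ->
  measurable_fun setT f -> (forall t, 0 <= f t) ->
  (forall t, c * f t <=
     alpha * delta * (pospow (theta0 + delta * phi t) (alpha - 1) * derive1 phi t)) ->
  ((c ^+ 2)%:E * `|'E_Q[f]| ^+ 2 / total_info n delta theta0 (fisher_info nu xi) Q phi
   <= minimax_risk P (fun x => pospow x alpha) n theta0 delta)%E.
Proof.
move=> phiA c0 mf f0 fPsi; apply: le_ereal_inf_tmp => _ [T mT <-].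
set risks := [set _ | _ in _].
have sup_ub t : `|t - theta0| < delta ->
    (\int[iid_law (P t) n]_x (`|T x - pospow t alpha| ^+ 2)%:E <= ereal_sup risks)%E.
  by move=> tD; apply: ereal_sup_ubound; exists t.
have sup_ge0 : (0 <= ereal_sup risks)%E.
  apply: le_trans (sup_ub theta0 _); last by rewrite subrr normr0.
  by apply: integral_ge0 => x _; rewrite lee_fin.
have [->|supfin] := eqVneq (ereal_sup risks) +oo%E; first exact: leey.
have supE : (fine (ereal_sup risks))%:E = ereal_sup risks.
  by rewrite fineK// ge0_fin_numE// ltey.
rewrite -supE in sup_ub *.
exact: (van_trees_bound phiA mT sup_ub).
Qed.

End minimax.

Lemma admissible_measurable (R : realType) (phi : R -> R) : admissible phi ->
  measurable_fun setT phi /\ measurable_fun setT (derive1 phi).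
Proof.
move=> [[_ _ [dphi cphi] _] _ _]; split; apply: continuous_measurable_fun => //.
by move=> t; apply: differentiable_continuous; apply/derivable1_diffP.
Qed.

Lemma measurable_ltb (R : realType) (f g : R -> R) :
  measurable_fun setT f -> measurable_fun setT g ->
  measurable_fun setT (fun t => (f t < g t)%R%:R : R).
Proof.
move=> mf mg.
have mb : measurable_fun setT (fun b : bool => b%:R : R) by [].
exact: (measurableT_comp mb (measurable_fun_ltr mf mg)).
Qed.

Lemma measurable_indicated (R : realType) (phi u f g : R -> R) a : admissible phi ->
  measurable_fun setT u -> measurable_fun setT f -> measurable_fun setT g ->
  measurable_fun setT (fun t => pospow (u t) a * derive1 phi t * (f t < g t)%R%:R).
Proof.
move=> /admissible_measurable[_ mdphi] mu mf mg.
apply: measurable_funM; last exact: measurable_ltb.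
apply: measurable_funM => //; exact: (measurableT_comp (measurable_pospow a)).
Qed.

Theorem lemma13 (R : realType) (d : measure_display) (X : measurableType d)
    (nu : {sigma_finite_measure set X -> \bar R})
    (alpha delta theta0 : R) (n : nat)
    (P : R -> probability X R) (p xi : R -> X -> R)
    (alpha_gt0 : 0 < alpha) (delta_gt0 : 0 < delta) (n_gt0 : (0 < n)%N)
    (density_p : forall t, `|t - theta0| < delta -> has_density nu (P t) (p t))
    (hellinger_p : forall t, `|t - theta0| < delta ->
       hellinger_derivative nu p t (xi t)) :
  let I := fisher_info nu xi in
  let psi := fun theta => pospow theta alpha in
  [/\ theta0 < 0 ->
      (ereal_sup
        [set (delta ^+ 2 * alpha ^+ 2)%:E *
             `| 'E_Q[fun t => (pospow (theta0 + delta * phi t) (alpha - 1) *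
                  derive1 phi t * (`|theta0| / delta < phi t)%R%:R)%R] | ^+ 2 /
             total_info n delta theta0 I Q phi
           | Q in [set: probability (measurableTypeR R) R] & phi in @admissible R]
       <= minimax_risk P psi n theta0 delta)%E,
      0 < theta0 ->
      (ereal_sup
        [set (delta ^+ 2 * alpha ^+ 2)%:E *
             `| 'E_Q[fun t => (pospow (theta0 + delta * phi t) (alpha - 1) *
                  derive1 phi t * (phi t < theta0 / delta)%R%:R)%R] | ^+ 2 /
             total_info n delta theta0 I Q phi
           | Q in [set: probability (measurableTypeR R) R] & phi in @admissible R]
       <= minimax_risk P psi n theta0 delta)%E &
      theta0 = 0 ->
      (ereal_sup
        [set (delta `^ (2 * alpha) * alpha ^+ 2)%:E *
             `| 'E_Q[fun t => (pospow (phi t) (alpha - 1) *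
                  derive1 phi t * (0 < phi t)%R%:R)%R] | ^+ 2 /
             total_info n delta theta0 I Q phi
           | Q in [set: probability (measurableTypeR R) R] & phi in @admissible R]
       <= minimax_risk P psi n theta0 delta)%E].
Proof.

move=> I psi.
have lower := minimax_bound alpha_gt0 delta_gt0 n_gt0 density_p hellinger_p.
have indicator_le (c u : R) (b : bool) : 0 <= u -> 0 < c -> c * (u * b%:R) <= c * u.
  by move=> u0 c0; rewrite ler_wpM2l ?(ltW c0)//; case: b; rewrite ?mulr1// mulr0.
have da0 : 0 < delta * alpha by exact: mulr_gt0.
have w0 phi (x a t : R) : admissible phi -> 0 <= pospow x a * derive1 phi t.
  by move=> phiA; rewrite mulr_ge0 ?pospow_ge0//; exact: admissible_derive_ge0.
have mtheta phi : admissible phi -> measurable_fun setT (fun t => theta0 + delta * phi t).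
  move=> /admissible_measurable[mphi _]; apply: measurable_funD => //.
  exact: measurable_funM.
split=> [_|_|th0]; apply: ge_ereal_sup => _ [Q _ [phi phiA <-]].
- rewrite -exprMn; apply: lower => //.
  + have [mphi _] := admissible_measurable phiA.
    exact: (@measurable_indicated R phi _ (cst (`|theta0| / delta)) phi _ phiA
      (mtheta _ phiA) (measurable_cst _) mphi).
  + by move=> t; rewrite mulr_ge0// w0.
  + by move=> t; rewrite [alpha * delta]mulrC indicator_le// w0.
- rewrite -exprMn; apply: lower => //.
  + have [mphi _] := admissible_measurable phiA.
    exact: (@measurable_indicated R phi _ phi (cst (theta0 / delta)) _ phiA
      (mtheta _ phiA) mphi (measurable_cst _)).
  + by move=> t; rewrite mulr_ge0// w0.
  + by move=> t; rewrite [alpha * delta]mulrC indicator_le// w0.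
have -> : delta `^ (2 * alpha) * alpha ^+ 2 = (delta `^ alpha * alpha) ^+ 2.
  by rewrite exprMn [2 * alpha]mulrC powRrM powR_mulrn ?powR_ge0.
have c0 : 0 < delta `^ alpha * alpha by rewrite mulr_gt0// powR_gt0.
apply: lower => //.
- have [mphi _] := admissible_measurable phiA.
  exact: (@measurable_indicated R phi phi (cst 0) phi _ phiA mphi (measurable_cst _) mphi).
- by move=> t; rewrite mulr_ge0// w0.
move=> t; apply: (le_trans (indicator_le _ _ _ _ c0)); first exact: w0.
rewrite th0 add0r pospowM// -(mulr_powRB1 (ltW delta_gt0) alpha_gt0).
by rewrite le_eqVlt; apply/orP; left; apply/eqP; ring.
Qed.
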